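(* For any $d$-dimensional polytope $P\subset\mathbb{R}^d$ ($d\ge2$) and any contracting reflection law $f$, the contracting billiard map $\Phi_{f,P}$ is uniformly partially hyperbolic.
   Context: **Polytopes.** A polytope is a compact finite intersection of closed half-spaces of $\mathbb{R}^d$. Let $P$ be a $d$-dimensional polytope with $(d-1)$-dimensional faces $F_1,\dots,F_N$, relative interiors $F_i^\circ$, inward unit normals $\eta_i$, and skeleton $\Sigma P=\bigcup_i\partial F_i$. **Notation.** $\mathbb{S}$ is the unit sphere of $\mathbb{R}^d$; $\mathbb{S}^+_\eta=\{v\in\mathbb{S}:\langle v,\eta\rangle>0\}$; $P_\eta(v)=\langle v,\eta\rangle\eta$; $P_{\eta^\perp}(v)=v-\langle v,\eta\rangle\eta$; $R_\eta(v)=v-2\langle v,\eta\rangle\eta$. **Contracting laws.** A contracting law is a family of $C^2$ maps $C_\eta:\mathbb{S}^+_\eta\to\mathbb{S}^+_\eta$, $\eta\in\mathbb{S}$, with: $C_\eta(\eta)=\eta$; $C_\eta(v)=a_\eta(v)P_\eta(v)+b_\eta(v)P_{\eta^\perp}(v)$ for non-negative $C^2$ functions $a_\eta,b_\eta$; $0<\sup_{v}\|DC_\eta(v)\|<1$; $O\circ C_\eta=C_{O\eta}\circ O$ for every orthogonal $O$. It is determined by a $C^2$ function $f:[0,\pi/2)\to[0,\pi/2)$ with $f(0)=0$ and $0<\lambda(f):=\sup|f'|<1$, through $C_\eta(v)=\frac{\cos f(\theta)}{\cos\theta}P_\eta(v)+\frac{\sin f(\theta)}{\sin\theta}P_{\eta^\perp}(v)$,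 $\theta=\arccos\langle v,\eta\rangle$. Such an $f$ is called a contracting reflection law. **Billiard map.** $M=\bigcup_i F_i^\circ\times\mathbb{S}^+_{\eta_i}$; $M'$ is the set of $(p,v)\in M$ such that the half-line $\{p+tv:t\ge0\}$ does not meet $\Sigma P$. For $(p,v)\in M'$ let $\tau>0$ be the least $t>0$ with $p+tv\in F_j^\circ$ for some $j$; then $\Phi_{f,P}(p,v)=(p+\tau v,\,C_{\eta_j}(R_{\eta_j}(v)))$. Write $\Phi=\Phi_{f,P}$. $M^+=\{x\in M:\Phi^n(x)\in M'\ \forall n\ge0\}$ and $D=\bigcap_{n\ge0}\Phi^n(M^+)$; the source states that $D$ is invariant and that $\Phi$ and its inverse are defined on $D$. **Partial hyperbolicity.** $\Phi$ is uniformly partially hyperbolic (meaning on $D$) if for every $x\in D$ there is a continuous splitting $T_xM=E^s(x)\oplus E^{cu}(x)$ with $D\Phi(E^s(x))=E^s(\Phi(x))$, $D\Phi(E^{cu}(x))=E^{cu}(\Phi(x))$, and constants $\lambda<1$, $\sigma\ge1$, $C>0$ such that for all $n\ge1$: $\|D\Phi^n|_{E^s}\|\le C\lambda^n$ and $\|D\Phi^{-n}|_{E^{cu}}\|\le C\sigma^{-n}$.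
   Formalization: The equality DΦ(E^s(x)) = E^s(Φ(x)) is asserted only where DΦ is invertible on T_xM, with inclusion elsewhere, since it fails when f'(0)=0 (e.g. f(t)=t³/8 in a square, orthogonal 2-periodic orbit); D Φ^{-n} on E^cu is the inverse of DΦ^n restricted to E^cu. *)

(* Defs.v *)
From HB Require Import structures.
From mathcomp Require Import all_boot all_order all_algebra.
From mathcomp Require Import all_classical all_reals all_analysis.

Set Implicit Arguments.
Unset Strict Implicit.
Unset Printing Implicit Defensive.

Import Order.TTheory GRing.Theory Num.Theory.
Import numFieldNormedType.Exports.

Local Open Scope classical_set_scope.
Local Open Scope ring_scope.

Section Geometry.
Context {R : realType} {d : nat}.
Local Notation V := 'rV[R]_d.
Implicit Types (A P F : set V) (p v x eta : V).

(* The library norm on 'rV[R]_d is the sup norm; all metric notions below use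
   the Euclidean inner product instead. The two topologies coincide. *)
Definition dot (u v : V) : R := \sum_(i < d) u 0 i * v 0 i.

Definition aff_hull A : set V :=
  [set x | exists (k : nat) (a : 'I_k -> V) (w : 'I_k -> R),
    [/\ forall i, A (a i), \sum_i w i = 1 & x = \sum_i w i *: a i]].

(* The affine hull is a translate of a k-dimensional linear subspace, given
   as the row space of U. *)
Definition has_dim A (k : nat) : Prop :=
  exists (x0 : V) (U : 'M[R]_d),
    \rank U = k /\ aff_hull A = [set x | (x - x0 <= U)%MS].

Definition relint A : set V :=
  [set x | A x /\ \forall y \near within (aff_hull A) (nbhs x), A y].

Definition relboundary A : set V := closure A `\` relint A.

Definition halfspace (a : V) (c : R) : set V := [set x | c <= dot x a].

Definition is_polytope P : Prop :=
  compact P /\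
  exists (n : nat) (a : 'I_n -> V) (c : 'I_n -> R),
    (forall i, a i != 0) /\ P = [set x | forall i, halfspace (a i) (c i) x].

Definition is_face P F : Prop :=
  exists (a : V) (c : R),
    [/\ a != 0, P `<=` halfspace a c & F = P `&` [set x | dot x a = c]].

Definition is_facet P F : Prop := is_face P F /\ has_dim F d.-1.

Definition inward_normal P F eta : Prop :=
  dot eta eta = 1 /\
  exists c : R, P `<=` halfspace eta c /\ F `<=` [set x | dot x eta = c].

Definition facet_interiors P : set V :=
  [set p | exists2 F, is_facet P F & relint F p].

Definition skeleton P : set V :=
  [set p | exists2 F, is_facet P F & relboundary F p].

Definition hemisphere eta : set V := [set v | dot v v = 1 /\ 0 < dot v eta].

Definition proj eta v : V := dot v eta *: eta.
Definition proj_orth eta v : V := v - dot v eta *: eta.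
Definition reflect_normal eta v : V := v - (2 * dot v eta) *: eta.

End Geometry.

Section ReflectionLaw.
Context {R : realType}.

(* Derivative relative to A; one-sided at an endpoint belonging to A. *)
Definition derivative_on (A : set R) (f f' : R -> R) : Prop :=
  forall t, A t ->
    (fun s => (f s - f t) / (s - t)) @ within A (dnbhs t) --> f' t.

(* Only the values of f on [0, pi/2) matter. The derivative f1 is uniquely
   determined on [0, pi/2). *)
Definition contracting_reflection_law (f : R -> R) : Prop :=
  let I := [set t : R | 0 <= t < pi / 2] in
  [/\ forall t, I t -> I (f t),
      f 0 = 0 &
      exists f1 f2 : R -> R,
        [/\ derivative_on I f f1,
            derivative_on I f1 f2,
            {within I, continuous f2} &
            (0 < ereal_sup [set `|f1 t|%:E | t in I] < 1)%E]].

(* At v = eta the second quotient is 0 / 0 = 0 and multiplies the zero vector,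
   so that the value is eta. *)
Definition contracting_law {d : nat} (f : R -> R) (eta v : 'rV[R]_d) :
    'rV[R]_d :=
  let theta := acos (dot v eta) in
  (cos (f theta) / cos theta) *: proj eta v
  + (sin (f theta) / sin theta) *: proj_orth eta v.

End ReflectionLaw.

Section BilliardMap.
Context {R : realType} {d : nat}.
Local Notation V := 'rV[R]_d.
Local Notation W := (V * V)%type.
Implicit Types (P : set V) (f : R -> R) (x y : W).

Definition phase_space P : set W :=
  [set x | exists (F : set V) (eta : V),
    [/\ is_facet P F, inward_normal P F eta,
        relint F x.1 & hemisphere eta x.2]].

Definition billiard_domain P : set W :=
  [set x | phase_space P x /\
    forall t : R, 0 <= t -> ~ skeleton P (x.1 + t *: x.2)].

Definition billiard_step f P x y : Prop :=
  exists (tau : R) (F : set V) (eta : V),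
    [/\ 0 < tau,
        forall t, 0 < t < tau -> ~ facet_interiors P (x.1 + t *: x.2),
        is_facet P F /\ relint F (x.1 + tau *: x.2),
        inward_normal P F eta &
        y = (x.1 + tau *: x.2,
             contracting_law f eta (reflect_normal eta x.2))].

(* Made total: the value is x itself when there is no next collision, which
   does not happen on billiard_domain. *)
Definition billiard_map f P x : W := xget x [set y | billiard_step f P x y].

Definition billiard_tangent P x : set W :=
  [set h | exists (F : set V) (eta : V),
    [/\ is_facet P F, relint F x.1, inward_normal P F eta,
        dot h.1 eta = 0 & dot h.2 x.2 = 0]].

End BilliardMap.

Section PartialHyperbolicity.
Context {R : realType} {d : nat}.
Local Notation V := 'rV[R]_d.
Local Notation W := (V * V)%type.

Definition enorm (u : W) : R := Num.sqrt (dot u.1 u.1 + dot u.2 u.2).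

(* Derivative at x of a map F defined on the submanifold A: L is determined
   only on the tangent space of A at x, and only its restriction to that space
   is used. *)
Definition is_derivative_along (A : set W) (F : W -> W) (x : W)
    (L : 'End(W)) : Prop :=
  forall e : R, 0 < e ->
    \forall y \near within A (nbhs x),
      enorm (F y - F x - L (y - x)) <= e * enorm (y - x).

Definition opnorm_le (L : 'End(W)) (E : {vspace W}) (c : R) : Prop :=
  forall u, u \in E -> enorm (L u) <= c * enorm u.

Definition gap_le (E1 E2 : {vspace W}) (e : R) : Prop :=
  forall u, u \in E1 -> exists2 w, w \in E2 & enorm (u - w) <= e * enorm u.

(* Continuity for the gap metric, i.e. for the topology of the
   Grassmannians. *)
Definition continuous_subspaces (D : set W) (E : W -> {vspace W}) : Prop :=
  forall x, D x -> forall e : R, 0 < e ->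
    \forall y \near within D (nbhs x),
      gap_le (E x) (E y) e /\ gap_le (E y) (E x) e.

Variables (M M' : set W) (Phi : W -> W).

Definition iter_domain (n : nat) : set W :=
  [set x | M x /\ forall k, (k < n)%N -> M' (iter k Phi x)].

Definition forward_domain : set W :=
  [set x | M x /\ forall n, M' (iter n Phi x)].

Definition invariant_domain : set W :=
  [set x | forall n, (iter n Phi @` forward_domain) x].

(* DPhi n x is the derivative of Phi^n at x, and T x the tangent space of M.

   Nothing forces D Phi to be invertible on invariant_domain: for billiards and
   f(t) = t^2/4 it has rank d - 1 at the bounces orthogonal to parallel facets.
   At such a point D Phi(Es x) is strictly smaller than Es (Phi x) for any
   splitting with the other properties. Hence D Phi(Es x) = Es (Phi x) is
   asserted wherever D Phi is invertible, and D Phi(Es x) <= Es (Phi x)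
   everywhere. If D Phi is invertible on invariant_domain, then this is the
   usual definition.

   D Phi^-n on Ecu (Phi^n x) is the inverse K of D Phi^n : Ecu x ->
   Ecu (Phi^n x), which is meaningful without invertibility of D Phi. *)
Definition uniformly_partially_hyperbolic (T : W -> set W) : Prop :=
  let D := invariant_domain in
  exists (DPhi : nat -> W -> 'End(W)) (Es Ecu : W -> {vspace W})
         (lambda sigma C : R),
  [/\ forall n x, D x ->
        is_derivative_along (iter_domain n) (iter n Phi) x (DPhi n x),
      [/\ forall x, D x -> T x = [set u | u \in (Es x + Ecu x)%VS],
          forall x, D x -> (Es x :&: Ecu x = 0)%VS,
          continuous_subspaces D Es &
          continuous_subspaces D Ecu],
      forall x, D x ->
        [/\ (DPhi 1%N x @: Es x <= Es (Phi x))%VS,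
            (forall u, T x u -> DPhi 1%N x u = 0 -> u = 0) ->
              (DPhi 1%N x @: Es x)%VS = Es (Phi x) &
            (DPhi 1%N x @: Ecu x)%VS = Ecu (Phi x)],
      [/\ 0 < lambda < 1, 1 <= sigma & 0 < C] &
      forall n x, (0 < n)%N -> D x ->
        opnorm_le (DPhi n x) (Es x) (C * lambda ^+ n) /\
        exists K : 'End(W),
          {in Ecu x, cancel (DPhi n x) K} /\
          opnorm_le K (Ecu (iter n Phi x)) (C * sigma ^- n)].

End PartialHyperbolicity.

(* Main.v *)
(* The billiard map is a skew product over the velocities: the next velocity
   depends on the current one only, through the contracting law, so the
   velocity derivative contracts by a factor mu < 1. The positions tangent to
   the facet form an invariant bundle Ecu, on which the derivative is the
   oblique projection along the velocity onto the tangent space of the next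
   facet. After projection to the orthogonal complement of the velocity these
   maps do not contract, since the angle of reflection is at most the angle of
   incidence; on the invariant domain the outgoing angle is at most
   lam * pi / 2 < pi / 2, so this projection distorts norms by a bounded factor,
   and the inverse iterates on Ecu are uniformly bounded. The stable bundle is the
   graph of an operator from velocities to positions, namely the fixed point of
   the graph transform, a series converging at the rate mu^n uniformly on the
   domain; it is therefore continuous. *)

Require Import Defs.
From HB Require Import structures.
From mathcomp Require Import all_boot all_order all_algebra.
From mathcomp Require Import all_classical all_reals all_analysis.
From mathcomp Require Import ring lra.

Set Implicit Arguments.
Unset Strict Implicit.
Unset Printing Implicit Defensive.

Import Order.TTheory GRing.Theory Num.Theory.
Import numFieldNormedType.Exports.
Local Open Scope classical_set_scope.
Local Open Scope ring_scope.

(** Since [D Phi] may be singular, the stable bundle cannot be found by inverting it. Invariance of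
    a graph [S] is instead solved for the position: [S x w] is the pull-back of
    [S (Phi x) (A w) - tau *: w], with [A] the velocity derivative. This inverts only the action on
    positions, an oblique projection between transversal hyperplanes, and never [A]. Bounding the
    pull-backs one by one in the Euclidean norm would accumulate a constant at each collision. They
    are bounded through [transverse_sq], which does not grow along a backward orbit; the comparison
    with the Euclidean norm is made once, at the end, and costs the factor [1 / cos (lam * pi / 2)].
    The factor [mu] has to dominate both [|f'|], the rate along meridians, and [sin f / sin], the
    rate across them. The second can exceed [sup |f'|], so [mu] is built separately. The delicate
    point of the calculus is normal incidence, where polar coordinates degenerate: the derivative is
    written so that the coefficients of the discontinuous meridian vanish there. Facets enter the
    dynamics only through points near which [P] is a half-space. *)

Section EuclideanSpace.
Context {R : realType} {d : nat}.
Local Notation V := 'rV[R]_d.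
Implicit Types (u v w : V) (a : R).

(** * Euclidean inner product and norm *)

Lemma dotC u v : dot u v = dot v u.
Proof. by apply: eq_bigr => i _; rewrite mulrC. Qed.

Lemma dotDl u v w : dot (u + v) w = dot u w + dot v w.
Proof. by rewrite -big_split; apply: eq_bigr => i _; rewrite mxE mulrDl. Qed.

Lemma dotZl a u v : dot (a *: u) v = a * dot u v.
Proof. by rewrite mulr_sumr; apply: eq_bigr => i _; rewrite mxE mulrA. Qed.

Lemma dotNl u v : dot (- u) v = - dot u v.
Proof. by rewrite -scaleN1r dotZl mulN1r. Qed.

Lemma dotDr u v w : dot w (u + v) = dot w u + dot w v.
Proof. by rewrite !(dotC w) dotDl. Qed.

Lemma dotZr a u v : dot v (a *: u) = a * dot v u.
Proof. by rewrite !(dotC v) dotZl. Qed.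

Lemma dotNr u v : dot v (- u) = - dot v u.
Proof. by rewrite !(dotC v) dotNl. Qed.

Lemma dot0l u : dot 0 u = 0.
Proof. by rewrite -(scale0r 0) dotZl mul0r. Qed.

Lemma dot0r u : dot u 0 = 0.
Proof. by rewrite dotC dot0l. Qed.

Lemma dot_suml (I : finType) (F : I -> V) v :
  dot (\sum_i F i) v = \sum_i dot (F i) v.
Proof. by elim/big_rec2: _ => [|i y z _ <-]; rewrite ?dot0l ?dotDl. Qed.

Definition dotE := (dotDl, dotDr, dotZl, dotZr, dotNl, dotNr, dot0l, dot0r).

Lemma dot_ge0 u : 0 <= dot u u.
Proof. by apply: sumr_ge0 => i _; rewrite -expr2 sqr_ge0. Qed.

Lemma coord_sqr_le u i : u 0 i ^+ 2 <= dot u u.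
Proof.
rewrite /dot (bigD1 i) //= -expr2 lerDl.
by apply: sumr_ge0 => j _; rewrite -expr2 sqr_ge0.
Qed.

Lemma dot_eq0 u : (dot u u == 0) = (u == 0).
Proof.
apply/eqP/eqP => [u0|->]; last by rewrite dot0l.
apply/rowP => i; rewrite mxE; apply/eqP; rewrite -sqrf_eq0 eq_le sqr_ge0 andbT.
by rewrite -u0 coord_sqr_le.
Qed.

Lemma dot_gt0 u : (0 < dot u u) = (u != 0).
Proof. by rewrite lt_neqAle dot_ge0 andbT eq_sym dot_eq0. Qed.

Lemma dot_sqr_le u v : dot u v ^+ 2 <= dot u u * dot v v.
Proof.
have [->|v0] := eqVneq v 0; first by rewrite !dot0r expr0n mulr0.
have := dot_ge0 (dot v v *: u - dot u v *: v).
rewrite !dotE (dotC v u) => h; rewrite -dot_gt0 in v0.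
rewrite -(ler_pM2l v0); nra.
Qed.

Definition nrm u : R := Num.sqrt (dot u u).

Lemma nrm_ge0 u : 0 <= nrm u. Proof. exact: sqrtr_ge0. Qed.

Lemma sqr_nrm u : nrm u ^+ 2 = dot u u.
Proof. by rewrite sqr_sqrtr // dot_ge0. Qed.

Lemma nrm_le u a : 0 <= a -> (nrm u <= a) = (dot u u <= a ^+ 2).
Proof. by move=> a0; rewrite -sqr_nrm ler_pXn2r ?nnegrE ?nrm_ge0. Qed.

Lemma nrm_eq0 u : (nrm u == 0) = (u == 0).
Proof. by rewrite -sqrf_eq0 sqr_nrm dot_eq0. Qed.

Lemma nrm0 : nrm 0 = 0. Proof. by apply/eqP; rewrite nrm_eq0. Qed.

Lemma normr_dot_le u v : `|dot u v| <= nrm u * nrm v.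
Proof.
rewrite -[leLHS]sqrtr_sqr -sqrtrM ?dot_ge0 // ler_wsqrtr //; exact: dot_sqr_le.
Qed.

Lemma nrmZ a u : nrm (a *: u) = `|a| * nrm u.
Proof. by rewrite /nrm !dotE mulrA -expr2 sqrtrM ?sqr_ge0 // sqrtr_sqr. Qed.

Lemma nrmN u : nrm (- u) = nrm u.
Proof. by rewrite -scaleN1r nrmZ normrN1 mul1r. Qed.

Lemma nrmD u v : nrm (u + v) <= nrm u + nrm v.
Proof.
rewrite nrm_le ?addr_ge0 ?nrm_ge0 // !dotE (dotC v u) sqrrD !sqr_nrm.
by have := le_trans (ler_norm _) (normr_dot_le u v); lra.
Qed.

Lemma nrmB u v : nrm (u - v) <= nrm u + nrm v.
Proof. by rewrite -(nrmN v) nrmD. Qed.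

Lemma nrm_unit u : dot u u = 1 -> nrm u = 1.
Proof. by rewrite /nrm => ->; rewrite sqrtr1. Qed.

Lemma coord_le_nrm u i : `|u 0 i| <= nrm u.
Proof. by rewrite -sqrtr_sqr ler_wsqrtr // coord_sqr_le. Qed.

Lemma norm_le_nrm u : `|u| <= nrm u.
Proof.
rewrite /Num.Def.normr /= mx_normrE; apply/bigmax_leP; split.
  exact: nrm_ge0.
by move=> -[i j] _ /=; rewrite (ord1 i) coord_le_nrm.
Qed.

Lemma coord_le_norm u i : `|u 0 i| <= `|u|.
Proof.
rewrite [leRHS]/Num.Def.normr /= mx_normrE.
exact: (le_bigmax _ (fun ij : 'I_1 * 'I_d => `|u ij.1 ij.2|) (0, i)).
Qed.

Lemma nrm_le_norm u : nrm u <= d%:R * `|u|.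
Proof.
rewrite nrm_le ?mulr_ge0 ?ler0n //.
have -> : (d%:R * `|u|) ^+ 2 = d%:R * (\sum_(i < d) `|u| ^+ 2).
  by rewrite sumr_const card_ord -(mulr_natl (`|u| ^+ 2)) exprMn expr2; ring.
have h : dot u u <= \sum_(i < d) `|u| ^+ 2.
  apply: ler_sum => i _; rewrite -expr2 -(real_normK (num_real _)).
  by rewrite ler_pXn2r ?nnegrE //; exact: coord_le_norm.
have s0 : 0 <= \sum_(i < d) `|u| ^+ 2 by apply: sumr_ge0 => i _; rewrite sqr_ge0.
have [d0|d1] := posnP d; last by apply: (le_trans h); rewrite ler_peMl // ler1n.
rewrite [leLHS]big1 ?mulr_ge0 // => -[i Hi] _; exfalso.
by move: (Hi); rewrite d0.
Qed.

(** Equivalence of the two norms lets neighbourhoods be given by Euclidean balls; [d.+1] keeps the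
    divisor positive in dimension 0. *)
Lemma near_nrm (p : V) (Q : set V) :
  (\forall y \near p, Q y) <->
  exists2 r : R, 0 < r & forall y, nrm (y - p) < r -> Q y.
Proof.
split.
  move/nbhs_normP => [r /= r0 rQ]; exists r => // y yr; apply: rQ => /=.
  by rewrite distrC (le_lt_trans (norm_le_nrm _)).
move=> [r r0 rQ]; apply/nbhs_normP; exists (r / d.+1%:R) => /=.
  by rewrite divr_gt0 // ltr0n.
move=> y; rewrite /= distrC => yr; apply: rQ; apply: (le_lt_trans (nrm_le_norm _)).
apply: (@le_lt_trans _ _ (d.+1%:R * `|y - p|)).
  by rewrite ler_wpM2r // ler_nat leqnSn.
by rewrite mulrC -ltr_pdivlMr ?ltr0n.
Qed.

(** Two-sided in [s], so that a local property can be tested both along [h] and against it. *)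
Lemma near_line (p : V) (Q : set V) : (\forall y \near p, Q y) ->
  forall h, exists2 t : R, 0 < t & forall s : R, `|s| <= t -> Q (p + s *: h).
Proof.
move/near_nrm => [r r0 rQ] h; have h1 : 0 < nrm h + 1.
  by rewrite ltr_wpDl ?nrm_ge0.
exists (r / (nrm h + 1)); first by rewrite divr_gt0.
move=> s st; apply: rQ; rewrite addrC addKr nrmZ.
apply: (@le_lt_trans _ _ (r / (nrm h + 1) * nrm h)).
  by rewrite ler_wpM2r ?nrm_ge0.
by rewrite mulrAC ltr_pdivrMr // ltr_pM2l // ltrDl.
Qed.

(** * Limits by coordinates and in the Euclidean norm *)

Section Limits.
Context {T : Type} {F : set_system T} {FF : Filter F}.
Implicit Types (f g : T -> V) (k : T -> R).

Lemma cvg_rowP f u :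
  (f y @[y --> F] --> u) <-> (forall i, f y 0 i @[y --> F] --> u 0 i).
Proof.
split=> [fu i|fu].
  exact: (cvg_comp _ _ fu (@coord_continuous R 1 d 0 i u)).
apply/cvgrPdist_lt => e e0.
have : \forall y \near F, forall i, `|u 0 i - f y 0 i| < e / d.+1%:R.
  apply: filter_forall => i; move/cvgrPdist_lt : (fu i); apply.
  by rewrite divr_gt0 ?ltr0n.
apply: filterS => y h; apply: (le_lt_trans (norm_le_nrm _)).
have le1 : nrm (u - f y) <= d%:R * (e / d.+1%:R).
  apply: (le_trans (nrm_le_norm _)); rewrite ler_wpM2l //.
  rewrite /Num.Def.normr /= mx_normrE; apply/bigmax_leP; split.
    by rewrite divr_ge0 ?ltW ?ltr0n.
  by move=> -[i j] _ /=; rewrite (ord1 i) !mxE ltW.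
apply: (le_lt_trans le1); rewrite mulrCA gtr_pMr //.
by rewrite ltr_pdivrMr ?ltr0n // mul1r ltr_nat.
Qed.

Lemma cvg_nrmP f u :
  (f y @[y --> F] --> u) <->
  (forall e : R, 0 < e -> \forall y \near F, nrm (f y - u) <= e).
Proof.
split=> [fu e e0|fu]; last first.
  apply/cvgrPdist_le => e e0; apply: filterS (fu e e0) => y.
  by rewrite -normrN opprB; exact: (le_trans (norm_le_nrm _)).
move/cvgrPdist_le : fu => /(_ (e / d.+1%:R)).
rewrite divr_gt0 ?ltr0n // => /(_ isT); apply: filterS => y; rewrite -normrN opprB => h.
apply: (le_trans (nrm_le_norm _)).
apply: (@le_trans _ _ (d.+1%:R * `|f y - u|)).
  by rewrite ler_wpM2r // ler_nat leqnSn.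
by rewrite mulrC -ler_pdivlMr ?ltr0n.
Qed.

Lemma cvg_dot f g u v : f y @[y --> F] --> u -> g y @[y --> F] --> v ->
  dot (f y) (g y) @[y --> F] --> dot u v.
Proof.
move=> /cvg_rowP fu /cvg_rowP gv.
apply: cvg_big => [|i _]; last exact: cvgM.
exact: add_continuous.
Qed.

Lemma cvg_nrm f u : f y @[y --> F] --> u -> nrm (f y) @[y --> F] --> nrm u.
Proof.
move=> fu; have := cvg_comp _ _ (cvg_dot fu fu) (@sqrt_continuous R (dot u u)).
exact.
Qed.

End Limits.

Lemma dot_continuous v : continuous (fun u => dot u v).
Proof.
move=> u; apply: (@cvg_dot _ (nbhs u) (nbhs_filter u) id (fun=> v) u v) => //.
exact: cst_continuous.
Qed.

End EuclideanSpace.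

(** * Facets, flat boundary points and the first collision *)

Section Facets.
Context {R : realType} {d : nat}.
Local Notation V := 'rV[R]_d.
Implicit Types (P F : set V) (p q v x y n : V).

Lemma aff_hull_sub_hyperplane F n (c : R) : F `<=` [set x | dot x n = c] ->
  aff_hull F `<=` [set x | dot x n = c].
Proof.
move=> Fc x [k [a [w [Fa w1 ->]]]] /=.
rewrite dot_suml -[RHS]mul1r -w1 mulr_suml; apply: eq_bigr => i _.
by rewrite dotZl (Fc _ (Fa i)).
Qed.

Lemma mul_trmx_dot x n : x *m n^T = (dot x n)%:M.
Proof.
apply/matrixP => i j; rewrite !ord1 !mxE mulr1n.
by apply: eq_bigr => k _; rewrite mxE.
Qed.

Lemma sub_kermx_dot x n : (x <= kermx n^T)%MS = (dot x n == 0).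
Proof.
apply/sub_kermxP/eqP; rewrite mul_trmx_dot.
  by move/matrixP/(_ 0 0); rewrite !mxE mulr1n.
by move=> ->; apply/matrixP => i j; rewrite !mxE mul0rn.
Qed.

Lemma rank_kermx_dot n : n != 0 -> \rank (kermx n^T) = d.-1.
Proof. by move=> n0; rewrite mxrank_ker mxrank_tr rank_rV n0 subn1. Qed.

(** The direction space of the hull lies in the orthogonal complement of [n], and both have rank
    [d.-1]. Hence the relative interior of a facet is its interior in the supporting hyperplane. *)
Lemma aff_hull_facet F n (c : R) : n != 0 -> has_dim F d.-1 ->
  F `<=` [set x | dot x n = c] -> aff_hull F = [set x | dot x n = c].
Proof.
move=> n0 [x0 [U [rU FU]]] Fc; apply/seteqP; split.
  exact: aff_hull_sub_hyperplane.
have hullc := aff_hull_sub_hyperplane Fc; rewrite FU in hullc.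
have x0c : dot x0 n = c by apply: hullc; rewrite /= subrr sub0mx.
have UK : (U <= kermx n^T)%MS.
  apply/row_subP => i; rewrite sub_kermx_dot; apply/eqP.
  have : dot (x0 + row i U) n = c by apply: hullc; rewrite /= addrC addKr row_sub.
  by rewrite dotDl x0c => /eqP; rewrite -subr_eq0 addrC addKr => /eqP.
have KU : (kermx n^T <= U)%MS.
  by rewrite -(geq_leqif (mxrank_leqif_sup UK)) rU rank_kermx_dot.
move=> x /= xc; rewrite FU /=; apply: submx_trans KU.
by rewrite sub_kermx_dot !dotE xc x0c subrr.
Qed.

Lemma full_dim_sub_hyperplane P n (c : R) : has_dim P d -> n != 0 ->
  ~ P `<=` [set x | dot x n = c].
Proof.
move=> [x0 [U [rU PU]]] n0 /aff_hull_sub_hyperplane; rewrite PU => h.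
have full y : (y <= U)%MS by apply: submx_full; rewrite /row_full rU.
have := h (x0 + n) (full _); rewrite /= dotDl (h x0 (full _)) => /eqP.
by rewrite -subr_eq0 addrC addKr dot_eq0 (negPf n0).
Qed.

Lemma has_dim_hyperplane F p n : n != 0 -> F `<=` [set x | dot x n = dot p n] ->
  (\forall y \near p, dot y n = dot p n -> F y) -> has_dim F d.-1.
Proof.
move=> n0 Fp nearF; exists p, (kermx n^T); rewrite rank_kermx_dot //; split => //.
apply/seteqP; split => x /=.
  by move/(aff_hull_sub_hyperplane Fp) => /=; rewrite sub_kermx_dot !dotE => ->; rewrite subrr.
rewrite sub_kermx_dot => /eqP xp.
(* A point [x] of the hyperplane is an affine combination of [p] and the nearby point
   [p + t *: (x - p)], with weights [1 - t^-1] and [t^-1]. *)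
have [t t0 tF] := near_line nearF (x - p).
exists 2%N, (fun i => if i == 0 then p else p + t *: (x - p)),
  (fun i => if i == 0 then 1 - t^-1 else t^-1); split.
- move=> i; case: ifP => _.
    by apply: (nbhs_singleton nearF).
  by apply: tF; rewrite ?gtr0_norm // dotDl dotZl xp mulr0 addr0.
- by rewrite !big_ord_recl big_ord0 /= addr0 subrK.
- rewrite !big_ord_recl big_ord0 /=; apply/rowP => i; rewrite !mxE.
  by field; rewrite gt_eqF.
Qed.

(* In a neighbourhood of [p], [P] is the half-space with inward unit normal
   [n] whose boundary passes through [p]. *)
Definition flat P p n : Prop :=
  dot n n = 1 /\ \forall y \near p, P y <-> dot p n <= dot y n.

Lemma flat_mem P p n : flat P p n -> P p.
Proof. by case=> _ /nbhs_singleton [_]; apply. Qed.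

(** The hypothesis at [h = n' - dot n n' *: n] gives [(dot n n')^2 = 1], and the sign condition
    leaves the value 1. *)
Lemma orthogonal_eq n n' : dot n n = 1 -> dot n' n' = 1 -> 0 <= dot n n' ->
  (forall h, dot h n = 0 -> dot h n' = 0) -> n' = n.
Proof.
move=> n1 n1' nn' H.
have /H : dot (n' - dot n n' *: n) n = 0.
  by rewrite !dotE n1 mulr1 (dotC n') subrr.
rewrite !dotE n1' => k.
have k1 : dot n n' = 1 by nra.
by apply/eqP; rewrite -subr_eq0 -dot_eq0 !dotE (dotC n') k1 n1 n1'; apply/eqP; ring.
Qed.

Lemma unit_neq0 n : dot n n = 1 -> n != 0.
Proof. by move=> n1; rewrite -dot_eq0 n1 oner_neq0. Qed.

(** Every direction pointing into the local half-space points into the supporting one. Applied to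
    [h] and [- h] orthogonal to [n], this makes [n'] vanish on the complement of [n]. *)
Lemma flat_support P p n n' : flat P p n -> dot n' n' = 1 ->
  P `<=` halfspace n' (dot p n') -> n' = n.
Proof.
move=> [n1 nearP] n1' Pn'.
have pos h : 0 <= dot h n -> 0 <= dot h n'.
  move=> hn; have [t t0 tP] := near_line nearP h.
  have := tP t; rewrite gtr0_norm // => /(_ (lexx _)) [_].
  rewrite !dotE lerDl pmulr_rge0 // => /(_ hn)/Pn'.
  by rewrite /halfspace /= !dotE lerDl pmulr_rge0.
apply: orthogonal_eq => //; first by apply: pos; rewrite n1.
move=> h hn; apply/eqP; rewrite eq_le pos ?hn // andbT.
by have := pos (- h); rewrite !dotE hn oppr0 oppr_ge0; apply.
Qed.

Definition unit_vector n : V := (nrm n)^-1 *: n.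

Lemma dot_unit_vector n : n != 0 -> dot (unit_vector n) (unit_vector n) = 1.
Proof.
by move=> n0; rewrite !dotE -sqr_nrm; field; rewrite nrm_eq0.
Qed.

Lemma halfspace_unit_vector n (c : R) : n != 0 ->
  halfspace (unit_vector n) ((nrm n)^-1 * c) = halfspace n c.
Proof.
move=> n0; apply/seteqP; rewrite /halfspace /=.
by split => x /=; rewrite !dotE ler_pM2l // invr_gt0 lt_neqAle eq_sym nrm_eq0 n0 nrm_ge0.
Qed.

Lemma facet_normal P F : is_facet P F -> exists n, inward_normal P F n.
Proof.
move=> [[a [c [a0 Pa FE]]] _]; exists (unit_vector a); split.
  exact: dot_unit_vector.
exists ((nrm a)^-1 * c); rewrite halfspace_unit_vector //; split => //.
by rewrite FE => x [_ /= xc]; rewrite !dotE xc.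
Qed.

(** * Full-dimensional polytopes given by finitely many inequalities *)

Section Polytope.
Context {m : nat} (a : 'I_m -> V) (c : 'I_m -> R) (P : set V).
Hypotheses (a_neq0 : forall i, a i != 0) (PE : P = [set x | forall i, halfspace (a i) (c i) x])
  (dimP : has_dim P d).

Lemma polytope_conv x y (t : R) : P x -> P y -> 0 <= t <= 1 -> P (x + t *: (y - x)).
Proof.
rewrite PE => Px Py /andP[t0 t1] i; have := Px i; have := Py i.
by rewrite /halfspace /= !dotE; nra.
Qed.

(** Convexity makes the local inequality global: the segment from [p] to any [y] in [P] begins
    inside the neighbourhood where [P] is known. *)
Lemma flat_halfspace p n : flat P p n -> P `<=` halfspace n (dot p n).
Proof.
move=> fl y Py; have [_ nearP] := fl.
have [t t0 tP] := near_line nearP (y - p).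
have s0 : 0 < Num.min t 1 by rewrite lt_min t0 /=.
have := tP (Num.min t 1); rewrite gtr0_norm // ge_min lexx => /(_ isT) [+ _].
have Ps : P (p + Num.min t 1 *: (y - p)).
  by apply: polytope_conv => //; [exact: flat_mem fl|rewrite ltW //= ge_min lexx orbT].
by move=> /(_ Ps); rewrite /halfspace /= !dotE lerDl pmulr_rge0 // subr_ge0.
Qed.

Lemma flat_unique p n n' : flat P p n -> flat P p n' -> n = n'.
Proof.
move=> fl fl'; apply: (flat_support fl'); first by case: fl.
exact: flat_halfspace.
Qed.

Lemma near_strict p :
  \forall y \near p, forall i, c i < dot p (a i) -> c i < dot y (a i).
Proof.
suff H i : \forall y \near p, c i < dot p (a i) -> c i < dot y (a i).
  exact: (@filter_forall _ _ _ (nbhs p) (nbhs_filter p) H).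
have [h|h] := ltP (c i) (dot p (a i)); last first.
  by apply: (@filterE _ (nbhs p) (nbhs_filter p)) => y.
have /cvgr_gt/(_ _ h) := @dot_continuous R d (a i) p.
by apply: (@filterS _ (nbhs p) (nbhs_filter p)).
Qed.

(** For each [i] some point of [P] is strict in the [i]-th inequality, as [P] lies in no hyperplane.
    The mean of these points is strict in all of them. *)
Lemma exists_interior : exists h, forall i, c i < dot h (a i).
Proof.
have [m0|m_gt0] := posnP m.
  by exists 0 => i; exfalso; case: i => i; rewrite m0.
have /choice [x xP] : forall i, exists x, P x /\ c i < dot x (a i).
  move=> i; apply: contrapT => H; apply: (full_dim_sub_hyperplane dimP (a_neq0 i) (c := c i)).
  move=> x Px /=; apply/eqP; rewrite eq_le; have := Px; rewrite {1}PE => /(_ i).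
  rewrite /halfspace /= => ->; rewrite andbT leNgt; apply/negP => lt.
  by apply: H; exists x.
have m0' : 0 < m%:R :> R by rewrite ltr0n.
exists (m%:R^-1 *: \sum_i x i) => i.
rewrite dotZl dot_suml mulrC ltr_pdivlMr // mulr_natr -{1}(card_ord m) -sumr_const.
rewrite (bigD1 i) //= [ltRHS](bigD1 i) //=; apply: ltr_leD; first exact: (xP i).2.
apply: ler_sum => j _; have := (xP j).1; rewrite PE; exact.
Qed.

(** Near [p] only the constraints active at [p] matter. Each of them is constant along the facet, so
    its vector is a multiple of [n]; an interior point of [P] shows that the multiple is
    non-negative. All active constraints thus follow from the single inequality for [n]. *)
Lemma flat_of_relint F n p : is_facet P F -> inward_normal P F n -> relint F p ->
  flat P p n.
Proof.
move=> [faceF dimF] [n1 [e [Pe Fe]]] [Fp nearF]; split => //.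
have FP : F `<=` P by case: faceF => b [e' [_ _ ->]] x [].
have pe : dot p n = e by exact: Fe.
have nearF' : \forall y \near p, dot y n = e -> F y.
  move: nearF; rewrite (aff_hull_facet (unit_neq0 n1) dimF Fe).
  by rewrite /prop_near1 /within /=.
have orth i : dot p (a i) = c i -> forall h, dot h n = 0 -> dot h (a i) = 0.
  move=> pi; have half h : dot h n = 0 -> 0 <= dot h (a i).
    move=> hn; have [t t0 tF] := near_line nearF' h.
    have /FP : F (p + t *: h).
      by apply: tF; rewrite ?gtr0_norm // !dotE hn mulr0 addr0.
    by rewrite PE => /(_ i); rewrite /halfspace /= !dotE pi lerDl pmulr_rge0.
  move=> h hn; apply/eqP; rewrite eq_le half // andbT.
  by have := half (- h); rewrite !dotE hn oppr0 oppr_ge0; apply.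
have aE i : dot p (a i) = c i -> a i = dot (a i) n *: n.
  move=> pi; have := orth i pi (a i - dot (a i) n *: n).
  rewrite !dotE n1 mulr1 subrr (dotC n) => /(_ erefl) h.
  apply/eqP; rewrite -subr_eq0 -dot_eq0 !dotE n1 (dotC n (a i)).
  by apply/eqP; rewrite h; ring.
have [h0 h0a] := exists_interior.
have Ph0 : P h0 by rewrite PE => i; exact: ltW.
have k0 i : dot p (a i) = c i -> 0 <= dot (a i) n.
  move=> pi; have := h0a i; have := Pe _ Ph0; rewrite /halfspace /= -pe.
  by rewrite -pi (aE i pi) !dotE n1 mulr1; nra.
apply: filterS (near_strict p) => y ys; split => [/Pe|py]; first by rewrite pe.
rewrite PE => i; rewrite /halfspace /=.
have := FP _ Fp; rewrite {1}PE => /(_ i); rewrite /halfspace /= le_eqVlt.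
move=> /orP[/eqP/esym pi|/ys]; last exact: ltW.
by rewrite -pi (aE i pi) !dotE ler_wpM2l ?k0.
Qed.

(** The converse of [flat_of_relint]. Together they express the phase space, its tangent spaces and
    the billiard step by [flat] alone, with the facets quantified away. *)
Lemma flat_facet n p : flat P p n ->
  exists F, [/\ is_facet P F, inward_normal P F n & relint F p].
Proof.
move=> fl; have [n1 nearP] := fl; have Pn := flat_halfspace fl.
have n0 := unit_neq0 n1.
have nearF : \forall y \near p, dot y n = dot p n -> (P `&` [set x | dot x n = dot p n]) y.
  by apply: filterS nearP => y [_ Py] yp; split => //; apply: Py; rewrite yp.
have Fsub : P `&` [set x | dot x n = dot p n] `<=` [set x | dot x n = dot p n].
  by move=> x [].
have dimF := has_dim_hyperplane n0 Fsub nearF.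
exists (P `&` [set x | dot x n = dot p n]); split.
- by split => //; exists n, (dot p n).
- by split => //; exists (dot p n).
- split; first by split => //; exact: flat_mem fl.
  by rewrite (aff_hull_facet n0 dimF Fsub) /prop_near1 /within /=.
Qed.

Lemma facet_interiorsE p : facet_interiors P p <-> exists n, flat P p n.
Proof.
split=> [[F fF rp]|[n /flat_facet[F [fF _ rp]]]]; last by exists F.
have [n nF] := facet_normal fF; exists n; exact: flat_of_relint fF nF rp.
Qed.

Lemma phase_spaceE (x : V * V) : phase_space P x <->
  exists n, flat P x.1 n /\ hemisphere n x.2.
Proof.
split=> [[F [n [fF nF rp hv]]]|[n [/flat_facet[F [fF nF rp]] hv]]].
  by exists n; split => //; exact: flat_of_relint fF nF rp.
by exists F, n.
Qed.

Lemma billiard_tangentE (x h : V * V) : billiard_tangent P x h <->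
  exists n, [/\ flat P x.1 n, dot h.1 n = 0 & dot h.2 x.2 = 0].
Proof.
split=> [[F [n [fF rp nF hn hv]]]|[n [/flat_facet[F [fF nF rp]] hn hv]]].
  by exists n; split => //; exact: flat_of_relint fF nF rp.
by exists F, n.
Qed.

Lemma billiard_stepE f (x y : V * V) : billiard_step f P x y <->
  exists (tau : R) n, [/\ 0 < tau,
    forall t n', 0 < t < tau -> ~ flat P (x.1 + t *: x.2) n',
    flat P (x.1 + tau *: x.2) n &
    y = (x.1 + tau *: x.2, contracting_law f n (reflect_normal n x.2))].
Proof.
split=> [[tau [F [n [tau0 before [fF rp] nF ->]]]]|
         [tau [n [tau0 before /flat_facet[F [fF nF rp]] ->]]]].
  exists tau, n; split => //; last exact: flat_of_relint fF nF rp.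
  by move=> t n' /before H fl; apply: H; apply/facet_interiorsE; exists n'.
exists tau, F, n; split => // t /before H /facet_interiorsE[n' fl].
exact: H fl.
Qed.

Lemma interior_mem p : (forall i, c i < dot p (a i)) -> P p.
Proof. by move=> pa; rewrite PE => i; exact: ltW. Qed.

Lemma interior_not_flat p n : (forall i, c i < dot p (a i)) -> ~ flat P p n.
Proof.
move=> pa [n1 nearP].
have nearP' : \forall y \near p, dot p n <= dot y n.
  apply: filterS2 nearP (near_strict p) => y Py ys.
  by apply/Py/interior_mem => i; exact: ys.
have [t t0 /(_ (- t))] := near_line nearP' n.
by rewrite normrN gtr0_norm // => /(_ (lexx _)); rewrite !dotE n1; lra.
Qed.

Lemma flat_active p n : flat P p n -> exists i, dot p (a i) = c i.
Proof.
move=> fl; apply: contrapT => H; apply: (interior_not_flat _ (n := n) (p := p)) => // i.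
rewrite lt_neqAle; have := flat_mem fl; rewrite {1}PE => /(_ i).
rewrite /halfspace /= => ->; rewrite andbT; apply/eqP => e.
by apply: H; exists i.
Qed.

Lemma flat_active_normal p n i : flat P p n -> dot p (a i) = c i ->
  unit_vector (a i) = n.
Proof.
move=> fl pi; apply: (flat_support fl); first exact: dot_unit_vector.
rewrite dotZr halfspace_unit_vector // => x; rewrite {1}PE => /(_ i).
by rewrite pi.
Qed.

Lemma dot_unit_vector_gt0 v n : n != 0 -> (0 < dot v (unit_vector n)) = (0 < dot v n).
Proof.
move=> n0; rewrite dotZr pmulr_rgt0 // invr_gt0 lt_neqAle eq_sym nrm_eq0 n0.
exact: nrm_ge0.
Qed.

(** Constraints active at [p] have normal [n] and increase along [v]. The others are strict at [p]
    and hold at time [T], hence are strict in between because they are affine in time. *)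
Lemma flow_interior p v n (T t : R) : flat P p n -> 0 < dot v n ->
  P (p + T *: v) -> 0 < t < T -> forall i, c i < dot (p + t *: v) (a i).
Proof.
move=> fl vn PT /andP[t0 tT] i.
have := flat_mem fl; rewrite {1}PE => /(_ i); rewrite /halfspace /= le_eqVlt.
move=> /orP[/eqP/esym pi|pi].
  rewrite !dotE pi ltrDl pmulr_rgt0 //.
  by rewrite -dot_unit_vector_gt0 // (flat_active_normal fl pi).
by move: PT; rewrite PE => /(_ i); rewrite /halfspace /= !dotE; nra.
Qed.

(** A constraint active on arrival is strict at half the flight, so it decreases along [v]. *)
Lemma flow_transversal p v n n' (T : R) : flat P p n -> 0 < dot v n -> 0 < T ->
  flat P (p + T *: v) n' -> dot v n' < 0.
Proof.
move=> fl vn T0 fl'; have [i qi] := flat_active fl'.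
have := flow_interior fl vn (flat_mem fl') (t := T / 2) _ i.
have -> : 0 < T / 2 < T by apply/andP; split; lra.
move/(_ isT); rewrite -qi !dotE => h.
rewrite -(flat_active_normal fl' qi) -oppr_gt0 -dotNl dot_unit_vector_gt0 //.
by rewrite dotNl; nra.
Qed.

(** No earlier time can be the collision, since interior points are not flat, and no later one,
    since [T] comes before it. The step relation thus has one value, which [xget] returns. *)
Lemma flow_hit f p v n n' (T : R) : flat P p n -> 0 < dot v n -> 0 < T ->
  flat P (p + T *: v) n' ->
  billiard_map f P (p, v) =
    (p + T *: v, contracting_law f n' (reflect_normal n' v)).
Proof.
move=> fl vn T0 fl'; apply: xget_unique => [|y].
  apply/billiard_stepE; exists T, n'; split => // t m' tT.
  exact: interior_not_flat (flow_interior fl vn (flat_mem fl') tT).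
move=> /billiard_stepE[t [m' [t0 before flt ->]]] /=.
have [tT|Tt|tT] := ltgtP t T.
- case: (interior_not_flat (flow_interior fl vn (flat_mem fl') _) flt).
  by rewrite t0.
- by case: (before T n' _ fl'); rewrite T0.
- by subst t; rewrite (flat_unique flt fl').
Qed.

(** An irredundant constraint cuts out a facet. As [z] violates the [j]-th constraint only, the
    segment from [z] to an interior point [h] crosses the [j]-th hyperplane at a point [w] strict in
    all other constraints, so [P] is flat at [w]. *)
Lemma flat_boundary_facet j z q :
  (forall i, i != j -> c i <= dot z (a i)) -> dot z (a j) < c j ->
  P q -> dot q (a j) = c j -> exists2 F, is_facet P F & F q.
Proof.
move=> zi zj Pq qj; have [h h0] := exists_interior.
have hz : 0 < dot h (a j) - dot z (a j) by have := h0 j; lra.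
pose t := (c j - dot z (a j)) / (dot h (a j) - dot z (a j)).
have t0 : 0 < t by rewrite divr_gt0 // subr_gt0.
have t1 : t < 1 by rewrite ltr_pdivrMr // mul1r ltrD2r.
pose w := z + t *: (h - z).
have wj : dot w (a j) = c j by rewrite /w /t !dotE; field; rewrite gt_eqF.
have wi i : i != j -> c i < dot w (a i).
  by move=> ij; have := zi i ij; have := h0 i; rewrite /w !dotE; nra.
clearbody w.
have fl : flat P w (unit_vector (a j)).
  split; first exact: dot_unit_vector.
  apply: filterS (near_strict w) => y ys.
  have -> : (dot w (unit_vector (a j)) <= dot y (unit_vector (a j))) = (c j <= dot y (a j)).
    rewrite !dotZr wj ler_pM2l // invr_gt0 lt_neqAle eq_sym nrm_eq0 a_neq0.
    exact: nrm_ge0.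
  rewrite PE; split => [/(_ j)//|yj i].
  by have [->|/wi/ys/ltW] := eqVneq i j.
have [F [fF [n1 [e [Pe Fe]]] [Fw _]]] := flat_facet fl.
(* The facet through [w] comes with its own equation [b], [e']. Uniqueness of the support at [w]
   makes it proportional to the [j]-th equation, which [q] satisfies. *)
exists F => //; have [[b [e' [b0 Pb FE]]] _] := fF.
rewrite FE; split => //=; move: Fw; rewrite FE => -[Pw /= we].
have := flat_support fl (dot_unit_vector b0).
rewrite dotZr we halfspace_unit_vector // => /(_ Pb) be.
have := esym we; have k0 : nrm b != 0 by rewrite nrm_eq0.
have -> : b = nrm b *: unit_vector (a j).
  by rewrite -be scalerA mulfV // scale1r.
by move=> ->; rewrite !dotZr qj wj.
Qed.

Lemma flow_exit p v n (M : R) : (forall x, P x -> nrm x <= M) ->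
  flat P p n -> 0 < dot v n ->
  exists T i, [/\ 0 < T, P (p + T *: v) & dot (p + T *: v) (a i) = c i].
Proof.
move=> PM fl vn.
have M0 : 0 <= M by apply: le_trans (nrm_ge0 p) (PM _ (flat_mem fl)).
have Pp i : c i <= dot p (a i) by have := flat_mem fl; rewrite PE => /(_ i).
have v0 : v != 0 by apply/eqP => v0; rewrite v0 dot0l ltxx in vn.
have nv0 : 0 < nrm v by rewrite lt_neqAle eq_sym nrm_eq0 v0 nrm_ge0.
(* If no constraint decreased along [v], the ray would stay in [P] over a distance [2 * M + 1], more
   than the diameter allows. *)
have [i0 i0v] : exists i0, dot v (a i0) < 0.
  apply: contrapT => H; pose t := (2 * M + 1) / nrm v.
  have t0 : 0 <= t by rewrite divr_ge0 // ?ltW //; lra.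
  have : P (p + t *: v).
    rewrite PE => i; rewrite /halfspace /= !dotE.
    have vi : 0 <= dot v (a i) by rewrite leNgt; apply/negP => h; apply: H; exists i.
    by have := Pp i; nra.
  move/PM => h; have := nrmB (p + t *: v) p; rewrite addrC addKr nrmZ ger0_norm //.
  rewrite /t mulfVK ?gt_eqF //; have := PM _ (flat_mem fl); lra.
(* The time at which the [i]-th constraint becomes active; the exit time is the least one among the
   decreasing constraints. *)
pose g i := (dot p (a i) - c i) / - dot v (a i).
have [i iv imin] : exists2 i, dot v (a i) < 0 &
    forall k, dot v (a k) < 0 -> g i <= g k.
  by case: (@Order.TotalTheory.arg_minP _ _ _ i0 (fun i => dot v (a i) < 0) g i0v) => i; exists i.
have gE k : dot v (a k) < 0 -> g k * - dot v (a k) = dot p (a k) - c k.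
  by move=> kv; rewrite /g mulfVK // oppr_eq0 lt_eqF.
(* A constraint active at [p] has normal [n], so it increases along [v]; the decreasing one is
   strict at [p]. *)
have g0 : 0 < g i.
  rewrite divr_gt0 ?oppr_gt0 // subr_gt0 lt_neqAle Pp andbT; apply/eqP => /esym pi.
  have := vn; rewrite -(flat_active_normal fl pi) dot_unit_vector_gt0 //.
  by move/lt_trans => /(_ _ iv); rewrite ltxx.
exists (g i), i; split => //; last by rewrite !dotE; have := gE i iv; lra.
rewrite PE => k; rewrite /halfspace /= !dotE.
have [kv|kv] := ltP (dot v (a k)) 0; last by have := Pp k; nra.
by have := imin k kv; have := gE k kv; nra.
Qed.

End Polytope.

Lemma polytope_irredundant P : is_polytope P -> exists m (a : 'I_m -> V) (c : 'I_m -> R),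
  [/\ forall i, a i != 0, P = [set x | forall i, halfspace (a i) (c i) x] &
    forall j, exists2 z, forall i, i != j -> c i <= dot z (a i) & dot z (a j) < c j].
Proof.
move=> [_ [m [a [c [a0 PE]]]]]; elim: m a c a0 PE => [|m IH] a c a0 PE.
  by exists 0%N, a, c; split => // -[].
have [irr|] := pselect (forall j, exists2 z, forall i, i != j -> c i <= dot z (a i) & dot z (a j) < c j).
  by exists m.+1, a, c.
move=> /existsNP[j nj]; apply: (IH (a \o lift j) (c \o lift j)) => [i|]; first exact: a0.
rewrite PE; apply/seteqP; split => x /= xP i; first exact: xP.
have [k ->|->] := unliftP j i; first exact: xP.
rewrite /halfspace /= leNgt; apply/negP => xj; apply: nj; exists x => // i' ij.
by have [k e|e] := unliftP j i'; [rewrite e; exact: xP|rewrite e eqxx in ij].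
Qed.

Lemma compact_nrm_bounded P : compact P ->
  exists2 M : R, 0 <= M & forall x, P x -> nrm x <= M.
Proof.
move=> cP; have [M [_ HM]] := compact_bounded cP.
exists (d%:R * (`|M| + 1)) => [|x Px]; first by rewrite mulr_ge0 // addr_ge0.
apply: (le_trans (nrm_le_norm x)); rewrite ler_wpM2l //; apply: HM => //.
by rewrite (le_lt_trans (ler_norm M)) // ltrDl.
Qed.

(** The exit point lies in a facet; the domain excludes the skeleton, so the point is in the
    relative interior. *)
Lemma billiard_domain_hit P f (x : V * V) : is_polytope P -> has_dim P d ->
  billiard_domain P x -> exists n n' (T : R),
  [/\ flat P x.1 n, hemisphere n x.2, 0 < T, flat P (x.1 + T *: x.2) n' &
    billiard_map f P x =
      (x.1 + T *: x.2, contracting_law f n' (reflect_normal n' x.2))].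
Proof.
move=> polyP dimP [xP nosk].
have [m [a [c [a0 PE irr]]]] := polytope_irredundant polyP.
have [n [fl hv]] := (phase_spaceE a0 PE dimP x).1 xP.
have [M _ PM] := compact_nrm_bounded polyP.1.
have [T [i [T0 PT Ti]]] := flow_exit a0 PE PM fl hv.2.
have [z zi zj] := irr i.
have [F fF Fq] := flat_boundary_facet a0 PE dimP zi zj PT Ti.
have rF : relint F (x.1 + T *: x.2).
  apply: contrapT => nr; apply: (nosk T (ltW T0)); exists F => //.
  by split => //; exact: subset_closure.
have [n' nF] := facet_normal fF.
have fl' := flat_of_relint a0 PE dimP fF nF rF.
exists n, n', T; split => //.
by rewrite -(flow_hit a0 PE dimP f fl hv.2 T0 fl'); case: (x).
Qed.

End Facets.

(** * Derivatives of real functions and the extended law *)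

Section ReflectionLaws.
Context {R : realType}.
Implicit Types (f g : R -> R) (s t l : R).

Lemma is_derive_epsP g t l : is_derive t 1 g l <->
  forall e : R, 0 < e -> \forall s \near t, `|g s - g t - (s - t) * l| <= e * `|s - t|.
Proof.
have shift (h : R) (h0 : h != 0) :
    h^-1 *: (g (h *: 1 + t) - g t) - l =
    h^-1 * (g (t + h) - g t - (t + h - t) * l).
  have -> : h *: (1 : R) = h by rewrite [LHS]mulr1.
  rewrite (addrC t h).
  change (h^-1 * (g (h + t) - g t) - l = h^-1 * (g (h + t) - g t - (h + t - t) * l)).
  by field.
have shiftn e (h : R) (h0 : h != 0) :
    (`|l - h^-1 *: (g (h *: 1 + t) - g t)| <= e) =
    (`|g (t + h) - g t - (t + h - t) * l| <= e * `|t + h - t|).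
  rewrite distrC shift // normrM normfV ler_pdivrMl ?normr_gt0 //.
  by rewrite (addrC t h) addrK (mulrC e).
split=> [[dg gl] e e0|H].
  have : h^-1 *: (g (h *: 1 + t) - g t) @[h --> 0^'] --> l by rewrite -gl; exact: dg.
  move/cvgrPdist_le => /(_ e e0); rewrite near_withinE => h0.
  apply: ((@nbhs0P R R^o _ t).2 _); apply: filterS h0 => h Hh.
  have [->|hn0] := eqVneq h 0.
    by rewrite addr0 !subrr mul0r subrr normr0 mulr0.
  by rewrite -shiftn //; exact: Hh.
have dg : h^-1 *: (g (h *: 1 + t) - g t) @[h --> 0^'] --> l.
  apply/cvgrPdist_le => e e0; rewrite near_withinE.
  have := (@nbhs0P R R^o _ t).1 (H e e0); apply: filterS => h Hh hn0.
  by rewrite shiftn.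
split; first by apply/cvg_ex; exists l.
exact: cvg_lim dg.
Qed.

(** The difference quotient completed by the derivative at the base point: increments become exact
    products with a continuous factor. *)
Lemma is_derive_slope g t l : is_derive t 1 g l -> exists q : R -> R,
  [/\ forall s, g s - g t = (s - t) * q s, q t = l & q s @[s --> t] --> l].
Proof.
move/is_derive_epsP => H.
exists (fun s => if s == t then l else (g s - g t) / (s - t)); split.
- move=> s; case: eqVneq => [->|st]; first by rewrite !subrr mul0r.
  by rewrite mulrCA divff ?mulr1 // subr_eq0.
- by rewrite eqxx.
- apply/cvgrPdist_le => e e0; apply: filterS (H e e0) => s Hs.
  case: eqVneq => [_|st]; first by rewrite subrr normr0 ltW.
  have d0 : s - t != 0 by rewrite subr_eq0.
  have -> : l - (g s - g t) / (s - t) = - ((s - t)^-1 * (g s - g t - (s - t) * l)).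
    by field.
  by rewrite normrN normrM normfV ler_pdivrMl ?normr_gt0 // (mulrC _ e).
Qed.

Lemma derivative_on_eps (A : set R) f f' : derivative_on A f f' ->
  forall t, A t -> forall e : R, 0 < e ->
  \forall s \near t, A s -> `|f s - f t - (s - t) * f' t| <= e * `|s - t|.
Proof.
move=> H t At e e0; have /cvgrPdist_le/(_ e e0) := H t At.
rewrite near_withinE near_withinE; apply: filterS => s Hs As.
have [->|st] := eqVneq s t; first by rewrite !subrr mul0r subrr normr0 mulr0.
have d0 : s - t != 0 by rewrite subr_eq0.
have := Hs st As.
have -> : f' t - (f s - f t) / (s - t) = - ((s - t)^-1 * (f s - f t - (s - t) * f' t)).
  by field.
by rewrite normrN normrM normfV ler_pdivrMl ?normr_gt0 // (mulrC _ e).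
Qed.

Lemma derivative_on_continuous (A : set R) f f' t : derivative_on A f f' -> A t ->
  forall e : R, 0 < e -> \forall s \near t, A s -> `|f s - f t| <= e.
Proof.
move=> H At e e0; have k0 : 0 < `|f' t| + 1 by rewrite ltr_wpDl.
have : \forall s \near t, `|s - t| < e / (`|f' t| + 1).
  by apply/nbhs_normP; exists (e / (`|f' t| + 1)); rewrite /= ?divr_gt0 // => s /=; rewrite distrC.
apply: filterS2 (derivative_on_eps H At ltr01) => s Hs st As.
have := Hs As; rewrite mul1r; move: st; rewrite ltr_pdivlMr // => st h.
have := ler_normD (f s - f t - (s - t) * f' t) ((s - t) * f' t).
rewrite subrK normrM; nra.
Qed.

(* [f], extended to the left of 0 by its tangent line so that all derivatives
   become two-sided. *)
Record law_extension (lam : R) (f g g' : R -> R) : Prop := LawExtension {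
  law_lam : 0 <= lam < 1;
  law_eq : forall t, 0 <= t < pi / 2 -> f t = g t;
  law0 : g 0 = 0;
  law_derive : forall t, t < pi / 2 -> is_derive t 1 g (g' t);
  law_derive_cont : forall t, t < pi / 2 -> g' s @[s --> t] --> g' t;
  law_derive_le : forall t, t < pi / 2 -> `|g' t| <= lam;
  law_le : forall t, 0 <= t < pi / 2 -> 0 <= g t <= lam * t }.

Lemma pihalf_gt0 : 0 < pi / 2 :> R.
Proof. by have /andP[] := pihalf_02 R. Qed.

Lemma exists_law_extension f : contracting_reflection_law f ->
  exists lam g g', law_extension lam f g g'.
Proof.
move=> [fI f0 [f1 [f2 [df df1 _ /andP[sup0 sup1]]]]].
set I := [set t : R | 0 <= t < pi / 2] in df df1 sup0 sup1.
set S := ereal_sup _ in sup0 sup1.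
have [lam lamE] : exists lam : R, S = lam%:E.
  by case: S sup0 sup1 => [r| |] //=; exists r.
move: sup0 sup1; rewrite lamE !lte_fin => lam0 lam1.
have f1le t : I t -> `|f1 t| <= lam.
  by move=> It; rewrite -lee_fin -lamE; apply: ereal_sup_ubound; exists t.
have I0 : I 0 by rewrite /I /= lexx pihalf_gt0.
pose g t := if t < 0 then t * f1 0 else f t.
pose g' t := f1 (Num.max 0 t).
have g0 : g 0 = 0 by rewrite /g ltxx.
have gE t : 0 <= t -> g t = f t by move=> t0; rewrite /g ltNge t0.
have g'E t : 0 <= t -> g' t = f1 t by move=> t0; rewrite /g' max_r.
have g'N t : t <= 0 -> g' t = f1 0 by move=> t0; rewrite /g' max_l.
have Imax t : t < pi / 2 -> I (Num.max 0 t).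
  by move=> tp; rewrite /I /= le_max lexx gt_max pihalf_gt0.
have near_pihalf t : t < pi / 2 -> \forall s \near t, s < pi / 2 by exact: lt_nbhsl.
have dg t : t < pi / 2 -> is_derive t 1 g (g' t).
  move=> tp; apply/is_derive_epsP => e e0.
  have [t0|t0|t0] := ltgtP t 0.
  - have : \forall s \near t, s < 0 by exact: lt_nbhsl.
    apply: filterS => s s0; rewrite /g s0 t0 (g'N t (ltW t0)).
    by rewrite -mulrBl subrr normr0 mulr_ge0 // ltW.
  - have It : I t by rewrite /I /= ltW.
    have : \forall s \near t, 0 < s by exact: lt_nbhsr.
    move: (near_pihalf t tp) (derivative_on_eps df It e0).
    apply: filterS3 => s sp Hs s0; rewrite (gE s (ltW s0)) (gE t (ltW t0)) (g'E t (ltW t0)).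
    by apply: Hs; rewrite /I /= ltW.
  (* At 0 the tangent line on the left and the one-sided derivative of [f] on the right have the
     same slope [f1 0]. *)
  - move: (near_pihalf t tp); rewrite t0; move: (derivative_on_eps df I0 e0).
    apply: filterS2 => s Hs sp; rewrite g'N // g0 subr0.
    have [s0|s0] := ltP s 0.
      by rewrite /g s0 subr0 subrr normr0 mulr_ge0 // ltW.
    have Is : I s by rewrite /I /= s0.
    by have := Hs Is; rewrite (gE s s0) f0 subr0.
have g'le t : t < pi / 2 -> `|g' t| <= lam by move=> tp; exact/f1le/Imax.
exists lam, g, g'; split => //.
- by rewrite ltW.
- by move=> t /andP[t0 _]; rewrite gE.
- move=> t tp; apply/cvgrPdist_le => e e0.
  have cmax : Num.max 0 s @[s --> t] --> Num.max 0 t.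
    have -> : (fun s : R => Num.max 0 s) = (fun s => (s + `|s|) / 2).
      by apply/funext => s; case: (ltrP 0 s) => s0; [rewrite gtr0_norm|rewrite ler0_norm]; lra.
    have -> : Num.max 0 t = (t + `|t|) / 2.
      by case: (ltrP 0 t) => s0; [rewrite gtr0_norm|rewrite ler0_norm]; lra.
    apply: cvgM; last exact: cvg_cst.
    by apply: cvgD; [exact: cvg_id|exact: norm_continuous].
  have H : \forall s \near t, I (Num.max 0 s) -> `|g' s - g' t| <= e.
    exact: cmax (derivative_on_continuous df1 (Imax t tp) e0).
  apply: filterS2 H (near_pihalf t tp) => s Hs sp.
  by rewrite distrC; exact: Hs (Imax s sp).
- move=> t /andP[t0 tp]; rewrite gE //.
  have It : I t by apply/andP.
  have /andP[-> _] : I (f t) := fI t It.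
  move: t0; rewrite le_eqVlt => /orP[/eqP<-|t0]; first by rewrite f0 mulr0 lexx.
  have cg : {within `[0, t], continuous g}.
    apply: derivable_within_continuous => s; rewrite in_itv /= => /andP[_ st].
    by have [] := dg s (le_lt_trans st tp).
  have [c|c] := MVT t0 _ cg (df := g').
    by rewrite in_itv /= => /andP[_ ct]; apply: dg; exact: lt_trans tp.
  rewrite in_itv /= => /andP[c0 ct]; rewrite g0 !subr0 (gE t (ltW t0)) => ->.
  rewrite ler_pM2r // (le_trans (ler_norm _)) // g'le //; exact: lt_trans tp.
Qed.

End ReflectionLaws.

(** * Angle and contraction estimates for the law *)

Section ReflectionEstimates.
Context {R : realType} (lam : R) (f g g' : R -> R).
Hypothesis lawE : law_extension lam f g g'.
Implicit Types (s t : R).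

Lemma acos_pihalf s : 0 < s <= 1 -> 0 <= acos s < pi / 2.
Proof.
move=> /andP[s0 s1]; have sI : -1 <= s <= 1 by apply/andP; split => //; lra.
have [/andP[a0 api] cs] := acos_def sI; rewrite a0 /=.
have p0 := pi_gt0 R.
rewrite -ltr_cos ?in_itv /= ?a0 ?api //; last by apply/andP; split; lra.
by rewrite cos_pihalf cs.
Qed.

Lemma cos_ge_gt0 s t : 0 <= s <= t -> t < pi / 2 -> 0 < cos t <= cos s.
Proof.
move=> /andP[s0 st] tp; have p0 := pi_gt0 R.
rewrite cos_gt0_pihalf /=; last by apply/andP; split; lra.
move: st; rewrite le_eqVlt => /orP[/eqP->|st]; first exact: lexx.
by rewrite ltW // ltr_cos // in_itv /=; apply/andP; split; lra.
Qed.

Lemma law_cos_ge t : 0 <= t < pi / 2 -> cos t <= cos (g t).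
Proof.
move=> tI; have /andP[g0 gt] := law_le lawE tI; have /andP[l0 l1] := law_lam lawE.
have /andP[t0 tp] := tI.
by have /andP[] : 0 < cos t <= cos (g t) by apply: cos_ge_gt0 => //; apply/andP; split => //; nra.
Qed.

Definition law_cos_min : R := cos (lam * (pi / 2)).

Lemma law_cos_min_gt0 : 0 < law_cos_min.
Proof.
have /andP[l0 l1] := law_lam lawE; have p0 := pihalf_gt0 (R := R).
by apply: cos_gt0_pihalf; apply/andP; split; nra.
Qed.

Lemma law_cos_min_le t : 0 <= t < pi / 2 -> law_cos_min <= cos (g t).
Proof.
move=> tI; have /andP[g0 gt] := law_le lawE tI; have /andP[l0 l1] := law_lam lawE.
have /andP[t0 tp] := tI; have p0 := pihalf_gt0 (R := R).
have /andP[] // : 0 < cos (lam * (pi / 2)) <= cos (g t).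
by apply: cos_ge_gt0; [apply/andP; split => //|]; nra.
Qed.

Lemma sin_le_id t : 0 <= t -> sin t <= t.
Proof.
rewrite le_eqVlt => /orP[/eqP<-|t0]; first by rewrite sin0.
have cs : {within `[0, t], continuous (@sin R)}.
  by apply: continuous_subspaceT; exact: continuous_sin.
have [c _] := MVT t0 (fun x _ => is_derive_sin x) cs.
by rewrite sin0 !subr0 => ->; have := cos_le1 c; nra.
Qed.

Lemma sin_ge_gt0 s t : 0 <= s <= t -> t < pi / 2 -> 0 <= sin s <= sin t.
Proof.
move=> /andP[s0 st] tp; have p0 := pi_gt0 R.
rewrite sin_ge0_pi /=; last by apply/andP; split; lra.
move: st; rewrite le_eqVlt => /orP[/eqP->|st]; first exact: lexx.
by rewrite ltW // ltr_sin // in_itv /=; apply/andP; split; lra.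
Qed.

(** [sin (lam * t) / sin t] approaches [sin (lam * pi / 2)] at [pi / 2], which may exceed [lam], so
    [lam] itself cannot serve. With [k] halfway between [lam] and 1, the mean value theorem on
    [[lam * t, k * t]] gives [sin (k * t) - sin (lam * t) >= c * (k - lam) * sin t], where
    [c = cos (k * pi / 2) > 0]; moreover [sin (k * t) <= sin t]. *)
Lemma sin_scale_le : exists mu : R, [/\ 0 < mu < 1, lam <= mu &
  forall t, 0 <= t < pi / 2 -> sin (lam * t) <= mu * sin t].
Proof.
have /andP[l0 l1] := law_lam lawE; have p0 := pihalf_gt0 (R := R).
pose k := (1 + lam) / 2; pose c := cos (k * (pi / 2)).
have k1 : k < 1 by rewrite /k; lra.
have lk : lam < k by rewrite /k; lra.
have c0 : 0 < c by apply: cos_gt0_pihalf; apply/andP; split; nra.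
have c1 : c <= 1 := cos_le1 _.
have kl : k - lam = (1 - lam) / 2 by rewrite /k; field.
exists (1 - c * (k - lam)); split.
- by apply/andP; split; nra.
- by nra.
move=> t /andP[t0 tp]; move: (t0); rewrite le_eqVlt => /orP[/eqP<-|t_gt0].
  by rewrite mulr0 sin0 mulr0.
have lt : lam * t < k * t by nra.
have cs : {within `[lam * t, k * t], continuous (@sin R)}.
  by apply: continuous_subspaceT; exact: continuous_sin.
have [x] := MVT lt (fun x _ => is_derive_sin x) cs.
rewrite in_itv /= => /andP[x0 x1] E.
have /andP[_ cx] : 0 < cos (k * (pi / 2)) <= cos x.
  by apply: cos_ge_gt0; [apply/andP; split|]; nra.
have /andP[_ sk] : 0 <= sin (k * t) <= sin t.
  by apply: sin_ge_gt0 => //; apply/andP; split; nra.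
have := sin_le_id t0; have ckl : 0 < c * (k - lam) by rewrite mulr_gt0 // subr_gt0.
have : c * ((k - lam) * t) <= cos x * (k * t - lam * t).
  by rewrite -mulrBl ler_wpM2r // mulr_ge0 // subr_ge0 ltW.
move=> h1 h2; have : c * (k - lam) * sin t <= c * (k - lam) * t by rewrite ler_wpM2l // ltW.
by move: E h1 sk; rewrite -/c; lra.
Qed.

Lemma law_sin_le : exists mu : R, [/\ 0 < mu < 1, lam <= mu &
  forall t, 0 <= t < pi / 2 -> 0 <= sin (g t) <= mu * sin t].
Proof.
have [mu [mu01 lm H]] := sin_scale_le; exists mu; split => // t tI.
have /andP[l0 l1] := law_lam lawE; have /andP[t0 tp] := tI.
have /andP[s0 s1] : 0 <= sin (g t) <= sin (lam * t).
  by apply: sin_ge_gt0; [exact: law_le lawE _ tI|nra].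
by rewrite s0 /=; exact: le_trans (H t tI).
Qed.

(** The scaling of directions orthogonal to the meridian: a parallel of radius [sin t] goes to one
    of radius [sin (g t)]. The value at 0 is the limit. *)
Definition sin_ratio t : R := if t == 0 then g' 0 else sin (g t) / sin t.

Lemma sin_gt0_I t : 0 <= t < pi / 2 -> t != 0 -> 0 < sin t.
Proof.
move=> /andP[t0 tp] tn0; have p0 := pi_gt0 R; apply: sin_gt0_pi.
by rewrite lt_neqAle eq_sym tn0 t0 /=; lra.
Qed.

Lemma is_derive_sin_law t : t < pi / 2 ->
  is_derive t 1 (fun s => sin (g s)) (cos (g t) * g' t).
Proof.
move=> tp; exact: (is_derive1_comp (is_derive_sin (g t)) (law_derive lawE tp)).
Qed.

Lemma sin_ratio_cont t : 0 <= t < pi / 2 -> sin_ratio s @[s --> t] --> sin_ratio t.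
Proof.
move=> tI; have /andP[t0 tp] := tI; rewrite {2}/sin_ratio.
have csin : sin s @[s --> t] --> sin t by exact: continuous_sin.
case: eqVneq => [tE|tn0].
  move: tI t0 tp csin; rewrite {}tE => tI t0 tp _.
  (* Near 0 the ratio is the quotient of the slopes of [sin (g s)] and [sin s], which tend to [g' 0]
     and 1. *)
  have [q1 [q1E q10 q1c]] := is_derive_slope (is_derive_sin_law tp).
  have [q2 [q2E q20 q2c]] := is_derive_slope (is_derive_sin (0 : R)).
  move: q1c q2c; rewrite (law0 lawE) !cos0 mul1r => q1c q2c.
  have q12 : q1 s / q2 s @[s --> 0] --> g' 0.
    rewrite -[X in _ --> X](divr1 (g' 0)).
    by apply: cvgM => //; apply: cvgV => //; exact: oner_neq0.
  apply: cvg_trans q12; apply: near_eq_cvg.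
  have : \forall s \near 0, 0 < q2 s by move/cvgr_gt : q2c; apply; exact: ltr01.
  apply: filterS => s q2s; rewrite /sin_ratio; case: eqVneq => [->|s0].
    by rewrite q10 q20 (law0 lawE) !cos0 mul1r divr1.
  have := q1E s; have := q2E s; rewrite (law0 lawE) sin0 !subr0 => -> ->.
  by field; rewrite s0 gt_eqF.
have q12 : sin (g s) / sin s @[s --> t] --> sin (g t) / sin t.
  apply: cvgM; last by apply: cvgV => //; rewrite gt_eqF // sin_gt0_I.
  by have [/derivable1_diffP/differentiable_continuous] := is_derive_sin_law tp.
apply: cvg_trans q12; apply: near_eq_cvg.
have : \forall s \near t, 0 < s by apply: lt_nbhsr; rewrite lt_neqAle eq_sym tn0.
by apply: filterS => s s0; rewrite /sin_ratio gt_eqF.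
Qed.

Lemma sin_ratio_le : exists mu : R, [/\ 0 < mu < 1,
  forall t, t < pi / 2 -> `|g' t| <= mu &
  forall t, 0 <= t < pi / 2 -> `|sin_ratio t| <= mu].
Proof.
have [mu [mu01 lm H]] := law_sin_le.
have g'mu t : t < pi / 2 -> `|g' t| <= mu.
  by move=> tp; apply: le_trans lm; exact: law_derive_le lawE _ tp.
exists mu; split => // t tI.
rewrite /sin_ratio; case: eqVneq => [_|t0]; first exact/g'mu/pihalf_gt0.
have st := sin_gt0_I tI t0; have /andP[h1 h2] := H t tI.
by rewrite ger0_norm ?divr_ge0 ?(ltW st) // ler_pdivrMr.
Qed.

End ReflectionEstimates.

(** * The derivative of the contracting law on the sphere *)

Section ReflectionDerivative.
Context {R : realType} {d : nat} (lam : R) (f g g' : R -> R).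
Hypothesis lawE : law_extension lam f g g'.
Local Notation V := 'rV[R]_d.
Implicit Types (n u v w : V).

Local Notation ratio := (sin_ratio g g').

Definition angle n v : R := acos (dot v n).

(* The unit tangent vector at [v] to the great circle through [n] and [v],
   pointing away from [n]; it is 0 at [v = n]. *)
Definition meridian n v : V := (sin (angle n v))^-1 *: (cos (angle n v) *: v - n).

(** In polar coordinates about [n], the part of [w] orthogonal to [v] and to the meridian [e] is
    scaled by the ratio, and the meridional part goes to [g' t] times the meridian at the image,
    [cos (t - g t) *: e + sin (t - g t) *: v]. The ratio is applied to the whole tangential part and
    then corrected along [e], so that the formula stays valid at [v = n], where [e] is 0. *)
Definition law_derivative n v w : V :=
  let t := angle n v in let e := meridian n v in
  ratio t *: (w - dot w v *: v)
  + (g' t * sin (t - g t) * dot w e) *: v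
  + ((g' t * cos (t - g t) - ratio t) * dot w e) *: e.

Lemma dot_unit_le1 u v : dot u u = 1 -> dot v v = 1 -> -1 <= dot u v <= 1.
Proof.
by move=> u1 v1; rewrite -ler_norml (le_trans (normr_dot_le u v)) // !nrm_unit // mulr1.
Qed.

Section AtPoint.
Variables (n v : V).
Hypotheses (n1 : dot n n = 1) (hv : hemisphere n v).
Local Notation t := (angle n v).
Local Notation e := (meridian n v).

Lemma dot_hemisphere : 0 < dot v n <= 1.
Proof. by rewrite hv.2; have /andP[] := dot_unit_le1 hv.1 n1. Qed.

Lemma angleI : 0 <= t < pi / 2.
Proof. exact: acos_pihalf dot_hemisphere. Qed.

Lemma cos_angle : cos t = dot v n.
Proof.
by have /andP[h h1] := dot_hemisphere; rewrite acosK // in_itv /= h1 andbT; lra.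
Qed.

Lemma sin_angle_eq0 : (sin t == 0) = (t == 0).
Proof.
apply/idP/eqP => [/eqP s0|->]; last by rewrite sin0.
apply: contrapT => /eqP t0; have := sin_gt0_I angleI t0.
by rewrite s0 ltxx.
Qed.

Lemma angle_eq0 : t = 0 -> v = n.
Proof.
move=> t0; have := cos_angle; rewrite t0 cos0 => h.
apply/eqP; rewrite -subr_eq0 -dot_eq0 !dotE (dotC n v) -h n1 hv.1.
by apply/eqP; ring.
Qed.

Lemma meridian_orth : dot e v = 0.
Proof. by rewrite !dotE hv.1 mulr1 cos_angle (dotC n v) subrr mulr0. Qed.

Lemma sqr_sin_angle : sin t ^+ 2 = 1 - dot v n ^+ 2.
Proof. by have := cos2Dsin2 t; rewrite cos_angle; lra. Qed.

Lemma meridian_unit : t != 0 -> dot e e = 1.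
Proof.
move=> t0; have s0 : sin t != 0 by rewrite sin_angle_eq0.
rewrite !dotE cos_angle hv.1 n1 (dotC n v).
apply: (mulfI (expf_neq0 2 s0)); rewrite {2}sqr_sin_angle.
by field.
Qed.

Lemma meridian0 : t = 0 -> e = 0.
Proof. by move=> t0; rewrite /meridian t0 sin0 invr0 scale0r. Qed.

Lemma normal_frame : n = cos t *: v - sin t *: e.
Proof.
have [t0|t0] := eqVneq t 0.
  by rewrite t0 cos0 sin0 scale1r scale0r subr0 angle_eq0.
by rewrite scalerA mulfV ?sin_angle_eq0 // scale1r opprB addrC subrK.
Qed.

Lemma dot_meridian w : dot w n = cos t * dot w v - sin t * dot w e.
Proof. by rewrite {1}normal_frame dotDr dotNr !dotZr. Qed.

(** The law turns [v] along its great circle towards [n] through the angle [t - g t]. *)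
Lemma contracting_lawE :
  contracting_law f n v = cos (t - g t) *: v - sin (t - g t) *: e.
Proof.
rewrite /contracting_law -/t (law_eq lawE angleI) /Defs.proj /proj_orth -cos_angle.
have [t0|t0] := eqVneq t 0.
  rewrite t0 (law0 lawE) subrr sin0 cos0 angle_eq0 //.
  by rewrite divr1 mul0r !scale0r subr0 addr0 !scale1r.
have s0 : sin t != 0 by rewrite sin_angle_eq0.
have c0 : cos t != 0 by rewrite cos_angle gt_eqF //; have /andP[] := dot_hemisphere.
have cs := cos2Dsin2 t.
rewrite [X in _ = _ - X](_ : _ = (sin (t - g t) / sin t) *: (cos t *: v - n)); last first.
  by rewrite scalerA.
rewrite sinB cosB; apply/rowP => i; rewrite !mxE.
have -> : sin (g t) / sin t * (v 0 i - cos t * n 0 i) =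
  (cos t ^+ 2 + sin t ^+ 2) * (sin (g t) / sin t) * v 0 i - sin (g t) / sin t * cos t * n 0 i.
  by rewrite cs; field.
by field; rewrite s0.
Qed.

Lemma dot_contracting_law : dot (contracting_law f n v) n = cos (g t).
Proof.
rewrite contracting_lawE dotDl dotNl (dotZl _ v) (dotZl _ e) !dot_meridian.
have [t0|t0] := eqVneq t 0.
  rewrite (meridian0 t0) t0 (law0 lawE) subrr sin0 cos0 hv.1.
  by ring.
rewrite hv.1 (dotC v e) meridian_orth meridian_unit //.
have -> : cos (g t) = cos (t - (t - g t)) by congr cos; ring.
by rewrite [RHS]cosB; ring.
Qed.

(** A vector orthogonal to [n] sees only the tangential part of the velocity, which the law scales
    by the ratio. This is what makes [transverse_sq] monotone. *)
Lemma dot_contracting_law_orth w : dot w n = 0 ->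
  dot w (contracting_law f n v) = ratio t * dot w v.
Proof.
move=> wn; have := dot_meridian w; rewrite wn contracting_lawE dotDr dotNr (dotZr _ v) (dotZr _ e).
have [t0|t0] := eqVneq t 0.
  rewrite t0 cos0 sin0 (meridian0 t0) (law0 lawE) subrr cos0 sin0 dot0r => h.
  have -> : dot w v = 0 by lra.
  by ring.
have s0 : sin t != 0 by rewrite sin_angle_eq0.
move=> h; have we : dot w e = cos t / sin t * dot w v.
  by apply: (mulfI s0); rewrite mulrA mulrCA mulfV // mulr1; lra.
rewrite /sin_ratio (negPf t0) we.
have -> : sin (g t) = sin (t - (t - g t)) by congr sin; ring.
by rewrite [in RHS]sinB; field.
Qed.

Lemma law_derivative_linear : linear (law_derivative n v).
Proof.
move=> k u w; rewrite /law_derivative !(dotDl, dotZl).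
by apply/rowP => i; rewrite !mxE; ring.
Qed.

Lemma law_derivative_radial : law_derivative n v v = 0.
Proof.
rewrite /law_derivative hv.1 (dotC v) meridian_orth scale1r subrr.
by rewrite !mulr0 !scale0r scaler0 !addr0.
Qed.

Lemma law_derivative_tangent w :
  dot (law_derivative n v w) (contracting_law f n v) = 0.
Proof.
rewrite contracting_lawE /law_derivative.
have [t0|t0] := eqVneq t 0.
  rewrite (meridian0 t0) t0 (law0 lawE) subrr sin0 cos0 !dotE hv.1.
  by ring.
move: e meridian_orth (meridian_unit t0) => m ev ee.
by rewrite !dotE hv.1 (dotC v m) ev ee; ring.
Qed.

(** The images of the meridional part and of the part orthogonal to it remain orthogonal, so the
    squared norms add and each rate can be bounded separately. *)
Lemma law_derivative_le (mu : R) w : 0 <= mu ->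
  `|g' t| <= mu -> `|ratio t| <= mu ->
  nrm (law_derivative n v w) <= mu * nrm w.
Proof.
move=> mu0 gmu rmu; rewrite nrm_le ?mulr_ge0 ?nrm_ge0 // exprMn sqr_nrm.
have sq x : `|x| <= mu -> x ^+ 2 <= mu ^+ 2.
  by move=> h; rewrite -(real_normK (num_real x)) ler_pXn2r ?nnegrE.
have := sq _ gmu; have := sq _ rmu; rewrite /law_derivative.
set b := ratio t; set a := g' t; set C := cos (t - g t); set S := sin (t - g t).
have CS : C ^+ 2 + S ^+ 2 = 1 := cos2Dsin2 _.
have [t0|t0] := eqVneq t 0.
  rewrite (meridian0 t0) !dot0r !mulr0 scale0r scaler0 !addr0 => bm _.
  have -> : dot (b *: (w - dot w v *: v)) (b *: (w - dot w v *: v)) =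
      b ^+ 2 * (dot w w - dot w v ^+ 2).
    by rewrite !dotE hv.1 (dotC v w); ring.
  have : dot w v ^+ 2 <= dot w w by have := dot_sqr_le w v; rewrite hv.1 mulr1.
  by have := sqr_ge0 (dot w v); nra.
move=> bm am; move: e meridian_orth (meridian_unit t0) => m ev ee.
set c := dot w m.
have -> : dot (b *: (w - dot w v *: v) + (a * S * c) *: v + ((a * C - b) * c) *: m)
      (b *: (w - dot w v *: v) + (a * S * c) *: v + ((a * C - b) * c) *: m) =
    b ^+ 2 * (dot w w - dot w v ^+ 2 - c ^+ 2) + a ^+ 2 * c ^+ 2 * (C ^+ 2 + S ^+ 2).
  rewrite !dotE hv.1 (dotC v w) (dotC v m) (dotC m w) ev ee -/c.
  by ring.
rewrite CS mulr1.
have : 0 <= dot w w - dot w v ^+ 2 - c ^+ 2.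
  have := dot_ge0 (w - dot w v *: v - c *: m).
  rewrite !dotE hv.1 (dotC v w) (dotC v m) (dotC m w) ev ee -/c.
  by congr (_ <= _); ring.
by have := sqr_ge0 (dot w v); have := sqr_ge0 c; nra.
Qed.

End AtPoint.

End ReflectionDerivative.

(** * Differentiability of the law, including normal incidence *)

Section ReflectionDerivativeLimits.
Context {R : realType} {d : nat} (lam : R) (f g g' : R -> R).
Hypothesis lawE : law_extension lam f g g'.
Local Notation V := 'rV[R]_d.
Variables (n v : V).
Hypotheses (n1 : dot n n = 1) (hv : hemisphere n v).
Local Notation ratio := (sin_ratio g g').
Local Notation t := (angle n v).
Local Notation sphere_at := (within [set u : V | dot u u = 1] (nbhs v)).

Lemma near_sphere_at (Q : set V) :
  (\forall u \near v, dot u u = 1 -> Q u) -> \forall u \near sphere_at, Q u.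
Proof. by []. Qed.

Lemma cvg_sphere_at : u @[u --> sphere_at] --> v.
Proof. exact: cvg_within. Qed.

Lemma cvg_dot_sphere_at w : dot u w @[u --> sphere_at] --> dot v w.
Proof. by apply: cvg_dot; [exact: cvg_sphere_at|exact: cvg_cst]. Qed.

Lemma near_hemisphere : \forall u \near sphere_at, hemisphere n u.
Proof.
have := @cvg_dot_sphere_at n; move/cvgr_gt => /(_ _ hv.2).
have : \forall u \near sphere_at, dot u u = 1.
  by apply: near_sphere_at; apply: (@filterE _ (nbhs v) (nbhs_filter v)).
by apply: filterS2 => u u1 un; split.
Qed.

Lemma cvg_angle : angle n u @[u --> sphere_at] --> t.
Proof.
have cdot := @cvg_dot_sphere_at n; have /andP[s0 s1] := dot_hemisphere n1 hv.
have [s_lt1|] := ltP (dot v n) 1.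
  apply: (cvg_comp _ _ cdot); apply: continuous_acos.
  by apply/andP; split => //; lra.
(* At [v = n] the argument of [acos] is the endpoint 1; monotonicity of [cos] on [[0, pi]] gives the
   limit. *)
move=> s_ge1; have vn : dot v n = 1 by apply/eqP; rewrite eq_le s1 s_ge1.
have -> : t = 0 by rewrite /angle vn acos1.
have p0 := pi_gt0 R.
apply/cvgrPdist_le => e e0; pose b := Num.min e pi.
have b0 : 0 < b by rewrite lt_min e0.
have bpi : b <= pi by rewrite ge_min lexx orbT.
have cb : cos b < dot v n.
  by rewrite vn -(cos0 R) ltr_cos // in_itv /= ?lexx ?(ltW p0) ?(ltW b0).
move/cvgr_gt : cdot => /(_ _ cb).
apply: filterS2 near_hemisphere => u hu bu.
have /andP[a0 ap] := angleI n1 hu; have cu := cos_angle n1 hu.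
rewrite sub0r normrN ger0_norm //; apply: (@le_trans _ _ b); last by rewrite ge_min lexx.
rewrite leNgt; apply/negP => ba; move: bu; rewrite -cu ltr_cos ?in_itv /= ?a0 ?(ltW b0) //=.
  by move=> ab; have := lt_trans ab ba; rewrite ltxx.
by lra.
Qed.

Lemma cvg_comp_angle (h : R -> R) : h s @[s --> t] --> h t ->
  h (angle n u) @[u --> sphere_at] --> h t.
Proof. by move=> ht; apply: cvg_comp ht; exact: cvg_angle. Qed.

Lemma law_continuous s : s < pi / 2 -> g u @[u --> s] --> g s.
Proof.
by move=> sp; have [/derivable1_diffP/differentiable_continuous] := law_derive lawE sp.
Qed.

Lemma cvg_meridian : t != 0 -> meridian n u @[u --> sphere_at] --> meridian n v.
Proof.
move=> t0; apply: cvgZ.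
  apply: cvgV; first by rewrite sin_angle_eq0.
  by apply: cvg_comp_angle; exact: continuous_sin.
apply: cvgB; last exact: cvg_cst.
apply: cvgZ; last exact: cvg_sphere_at.
by apply: cvg_comp_angle; exact: continuous_cos.
Qed.

Lemma nrm_meridian_le1 u : hemisphere n u -> nrm (meridian n u) <= 1.
Proof.
move=> hu; have [u0|u0] := eqVneq (angle n u) 0.
  by rewrite (meridian0 u0) nrm0.
by rewrite nrm_unit // meridian_unit.
Qed.

(** The only difficulty is [v = n], where the meridian is discontinuous. Its norm is at most 1, and
    both of its coefficients tend to 0: [t - g t] vanishes at 0, and there the meridional and the
    parallel rates are both [g' 0]. *)
Lemma cvg_law_derivative w :
  law_derivative g g' n u w @[u --> sphere_at] --> law_derivative g g' n v w.
Proof.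
have tI := angleI n1 hv; have /andP[t0 tp] := tI.
have cg : g s @[s --> t] --> g t := law_continuous tp.
have cg' : g' s @[s --> t] --> g' t := law_derive_cont lawE tp.
have cD : s - g s @[s --> t] --> t - g t by apply: cvgB.
have cS : sin (s - g s) @[s --> t] --> sin (t - g t).
  by apply: (cvg_comp _ _ cD); exact: continuous_sin.
have cC : cos (s - g s) @[s --> t] --> cos (t - g t).
  by apply: (cvg_comp _ _ cD); exact: continuous_cos.
have cr : ratio s @[s --> t] --> ratio t := sin_ratio_cont lawE tI.
have c1 : ratio (angle n u) *: (w - dot w u *: u) @[u --> sphere_at] -->
    ratio t *: (w - dot w v *: v).
  apply: cvgZ; first exact: (cvg_comp_angle (h := ratio)).
  apply: cvgB; first exact: cvg_cst.
  apply: cvgZ; last exact: cvg_sphere_at.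
  by apply: cvg_dot; [exact: cvg_cst|exact: cvg_sphere_at].
have cx : (g' s * cos (s - g s) - ratio s) @[s --> t] -->
    g' t * cos (t - g t) - ratio t.
  by apply: cvgB => //; exact: cvgM.
have [tE|tn0] := eqVneq t 0; last first.
  have ce := cvg_meridian tn0.
  have cc : dot w (meridian n u) @[u --> sphere_at] --> dot w (meridian n v).
    by apply: cvg_dot => //; exact: cvg_cst.
  apply: cvgD; first apply: cvgD => //.
    apply: cvgZ; last exact: cvg_sphere_at.
    apply: cvgM => //.
    apply: (cvg_comp_angle (h := fun s => g' s * sin (s - g s))); exact: cvgM.
  apply: cvgZ => //; apply: cvgM => //.
  exact: (cvg_comp_angle (h := fun s => g' s * cos (s - g s) - ratio s)).
have small (h : R -> R) (b : V -> V) : h s @[s --> t] --> h t -> h t = 0 ->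
    (forall u, hemisphere n u -> nrm (b u) <= 1) ->
    (h (angle n u) * dot w (meridian n u)) *: b u @[u --> sphere_at] --> (0 : V).
  move=> ch ht bu; apply/cvg_nrmP => e e0.
  have := cvg_comp_angle ch; rewrite ht => /cvgrPdist_le.
  have k0 : 0 < nrm w + 1 by rewrite ltr_wpDl ?nrm_ge0.
  move/(_ (e / (nrm w + 1))); rewrite divr_gt0 // => /(_ isT).
  apply: filterS2 near_hemisphere => u hu; rewrite sub0r normrN subr0 nrmZ normrM => hh.
  have wm : `|dot w (meridian n u)| <= nrm w.
    by apply: (le_trans (normr_dot_le _ _)); rewrite ler_piMr ?nrm_ge0 ?nrm_meridian_le1.
  apply: (@le_trans _ _ (e / (nrm w + 1) * nrm w * 1)).
    rewrite ler_pM ?mulr_ge0 ?nrm_ge0 ?bu //.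
    by rewrite ler_pM.
  by rewrite mulr1 mulrAC ler_pdivrMr // ler_pM2l // lerDl.
rewrite /law_derivative [X in _ --> X](_ : _ =
    ratio t *: (w - dot w v *: v) + 0 + 0); last first.
  by rewrite (meridian0 tE) dot0r !mulr0 scale0r scaler0.
apply: cvgD; first apply: cvgD => //.
  apply: (small (fun s => g' s * sin (s - g s))); first exact: cvgM.
    by rewrite tE (law0 lawE) subrr sin0 mulr0.
  by move=> u hu; rewrite nrm_unit // hu.1.
apply: (small (fun s => g' s * cos (s - g s) - ratio s)) => //.
  by rewrite tE (law0 lawE) subrr cos0 mulr1 /sin_ratio eqxx subrr.
by move=> u hu; exact: nrm_meridian_le1.
Qed.

Lemma contracting_law_ratioE u : hemisphere n u ->
  contracting_law f n u =
    cos (g (angle n u)) *: n + ratio (angle n u) *: (u - dot u n *: n).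
Proof.
move=> hu; rewrite /contracting_law -/(angle n u) (law_eq lawE (angleI n1 hu)).
rewrite /Defs.proj /proj_orth; have cu := cos_angle n1 hu.
have u0 : dot u n != 0 by rewrite gt_eqF //; exact: hu.2.
congr (_ + _); first by rewrite scalerA cu divfK.
rewrite /sin_ratio; case: eqVneq => // uE.
by rewrite (angle_eq0 n1 hu uE) n1 scale1r subrr !scaler0.
Qed.

Lemma dot_subD_unit u : dot u u = 1 -> dot (u - v) (v + u) = 0.
Proof. by move=> u1; rewrite !dotE u1 hv.1 (dotC v u); ring. Qed.

(* Differentiability in Caratheodory's form. On the sphere [u - v] is
   orthogonal to [v + u], which is how the radial part of [u - v] drops out. *)
Lemma contracting_law_increment : exists T : V -> V -> V,
  [/\ forall u, linear (T u),
      \forall u \near sphere_at,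
        contracting_law f n u - contracting_law f n v = T u (u - v) &
      forall w, T u w @[u --> sphere_at] --> law_derivative g g' n v w].
Proof.
have tI := angleI n1 hv; have /andP[t0 tp] := tI.
have cr : ratio s @[s --> t] --> ratio t := sin_ratio_cont lawE tI.
have cv := cvg_sphere_at.
have [tE|tn0] := eqVneq t 0.
  have vn := angle_eq0 n1 hv tE.
  (* The change [cos g - 1] along [n] must be made linear in [u - n]. On the sphere [1 - dot u n] is
     half of [dot (u - n) (u - n)], so one factor [u - n] becomes the argument [w] and the other
     tends to 0; [rho] is bounded by 1 because the law does not increase angles. *)
  pose rho u := (1 - cos (g (angle n u))) / (1 - dot u n).
  exists (fun u w => ratio (angle n u) *: (w - dot w n *: n)
                     - (2^-1 * dot w (u - n) * rho u) *: n); split.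
  - move=> u k w w'; rewrite !dotDl !dotZl.
    by apply/rowP => i; rewrite !mxE; ring.
  - apply: filterS near_hemisphere => u hu.
    have rhoE : cos (g (angle n u)) - 1 = - ((1 - dot u n) * rho u).
      have [un|un] := eqVneq (1 - dot u n) 0.
        have -> : angle n u = 0 by rewrite /angle (_ : dot u n = 1) ?acos1 //; lra.
        by rewrite (law0 lawE) cos0 un mul0r subrr oppr0.
      by rewrite /rho mulrCA mulfV // mulr1 opprB.
    rewrite !contracting_law_ratioE // tE (law0 lawE) cos0 vn n1.
    have -> : dot (u - n) (u - n) = 2 * (1 - dot u n).
      by rewrite !dotE n1 hu.1 (dotC n u); ring.
    have -> : 2^-1 * (2 * (1 - dot u n)) * rho u = (1 - dot u n) * rho u by field.
    rewrite dotDl dotNl n1 !scale1r subrr scaler0 addr0.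
    have -> : (1 - dot u n) * rho u = 1 - cos (g (angle n u)) by lra.
    apply/rowP => i; rewrite !mxE; ring.
  - move=> w; rewrite [X in _ --> X](_ : _ = ratio t *: (w - dot w n *: n) - 0 *: n); last first.
      rewrite /law_derivative (meridian0 tE) dot0r !mulr0 !scale0r !addr0 subr0.
      by congr (_ *: (_ - _)); rewrite vn.
    apply: cvgB.
      by apply: cvgZ; [exact: (cvg_comp_angle (h := ratio))|exact: cvg_cst].
    apply: cvgZ; last exact: cvg_cst.
    have cw : dot w (u - n) @[u --> sphere_at] --> 0.
      have -> : 0 = dot w (v - n) by rewrite [in RHS]vn subrr dot0r.
      apply: cvg_dot; first exact: cvg_cst.
      by apply: cvgB; [exact: cv|exact: cvg_cst].
    apply/cvgrPdist_le => e e0; move/cvgrPdist_le : cw => /(_ e e0).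
    apply: filterS2 near_hemisphere => u hu; rewrite !sub0r !normrN => hw.
    have rho1 : `|rho u| <= 1.
      have h1 := law_cos_ge lawE (angleI n1 hu); rewrite (cos_angle n1 hu) in h1.
      have h2 := cos_le1 (g (angle n u)).
      have h3 : 0 <= 1 - cos (g (angle n u)) by rewrite subr_ge0.
      have h4 : 0 <= 1 - dot u n by rewrite subr_ge0 (le_trans h1).
      rewrite /rho normrM normfV (ger0_norm h3) (ger0_norm h4).
      have [e1|e1] := eqVneq (1 - dot u n) 0; first by rewrite e1 invr0 mulr0.
      by rewrite ler_pdivrMr ?mul1r ?lerD2l ?lerN2 // lt_neqAle eq_sym e1.
    move: (rho u) rho1 => r r1.
    rewrite !normrM ger0_norm ?invr_ge0 //; have := normr_ge0 (dot w (u - n)).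
    by have := normr_ge0 r; nra.
have s0 : 0 < sin t := sin_gt0_I tI tn0.
have cs := cos2Dsin2 t.
have cosE := cos_angle n1 hv.
have dacos : is_derive (dot v n) 1 acos (- (sin t)^-1).
  have := @is_derive1_acos R (dot v n).
  rewrite -cosE -sin2cos2 sqrtr_sqr gtr0_norm //; apply.
  have : 0 < sin t ^+ 2 by rewrite exprn_gt0.
  by move=> h; apply/andP; split; nra.
have dinv : is_derive t 1 (fun s => (sin s)^-1) (- (sin t) ^- 2 *: cos t).
  by apply: is_deriveV; rewrite gt_eqF.
have dg := law_derive lawE tp.
have d1 : is_derive t 1 (fun s => sin (g s) / sin s)
    (cos (g t) * g' t / sin t - sin (g t) * cos t / sin t ^+ 2).
  apply: (is_derive_eq (is_deriveM (is_derive_sin_law lawE tp) dinv)).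
  by rewrite /GRing.scale /=; field; rewrite gt_eqF.
have dsub : is_derive t 1 (fun s => s - g s) (1 - g' t).
  by apply: is_deriveB.
have dsin : is_derive t 1 (fun s => sin (s - g s)) (cos (t - g t) * (1 - g' t)).
  exact: (@is_derive1_comp R sin (fun s => s - g s) t _ _ (is_derive_sin _) dsub).
have d2 : is_derive t 1 (fun s => sin (s - g s) / sin s)
    (cos (t - g t) * (1 - g' t) / sin t - sin (t - g t) * cos t / sin t ^+ 2).
  apply: (is_derive_eq (is_deriveM dsin dinv)).
  by rewrite /GRing.scale /=; field; rewrite gt_eqF.
(* Away from [n] the law is a combination of [z] and [n] with coefficients depending on [dot z n]
   alone; [q1] and [q2] are the slopes of these coefficients at [dot v n]. *)
have [q1 [q1E q1v q1c]] := is_derive_slope (is_derive1_comp d1 dacos).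
have [q2 [q2E q2v q2c]] := is_derive_slope (is_derive1_comp d2 dacos).
(* The subtracted term vanishes at [w = u - v], so the increment is unchanged, while in the limit
   [w'] is the projection of [w] onto the tangent space at [v]. *)
pose w' (u w : V) := w - (2^-1 * dot w (v + u)) *: v.
exists (fun u w => ratio t *: w' u w + (dot (w' u w) n * q1 (dot u n)) *: u
                   + (dot (w' u w) n * q2 (dot u n)) *: n); split.
- move=> u k w1 w2; rewrite /w' !(dotDl, dotZl, dotNl).
  by apply/rowP => i; rewrite !mxE; ring.
- have near_t : \forall u \near sphere_at, angle n u != 0.
    have : 0 < t by rewrite lt_neqAle eq_sym tn0.
    have := cvg_angle; move/cvgr_gt => H /H; apply: filterS => u u0.
    by rewrite gt_eqF.
  apply: filterS2 near_hemisphere near_t => u hu u0.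
  have lawE' z : hemisphere n z -> angle n z != 0 -> contracting_law f n z =
      (sin (g (angle n z)) / sin (angle n z)) *: z +
      (sin (angle n z - g (angle n z)) / sin (angle n z)) *: n.
    move=> hz z0; rewrite contracting_law_ratioE // /sin_ratio (negPf z0).
    rewrite -(cos_angle n1 hz) sinB; apply/rowP => i; rewrite !mxE; field.
    by rewrite sin_angle_eq0.
  have w'E : w' u (u - v) = u - v.
    by rewrite /w' dot_subD_unit ?mulr0 ?scale0r ?subr0 //; exact: hu.1.
  rewrite w'E !dotE !lawE' //.
  have := q1E (dot u n); have := q2E (dot u n); rewrite /= -!/(angle n _) => <- <-.
  by rewrite /sin_ratio (negPf tn0); apply/rowP => i; rewrite !mxE; ring.
- move=> w.
  have cw' : w' u w @[u --> sphere_at] --> w - dot w v *: v.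
    apply: cvgB; first exact: cvg_cst.
    apply: cvgZ; last exact: cvg_cst.
    rewrite [X in _ --> X](_ : _ = 2^-1 * dot w (v + v)); last by rewrite dotDr; field.
    apply: cvgM; first exact: cvg_cst.
    apply: cvg_dot; first exact: cvg_cst.
    by apply: cvgD => //; exact: cvg_cst.
  have cw'n : dot (w' u w) n @[u --> sphere_at] --> dot (w - dot w v *: v) n.
    by apply: cvg_dot => //; exact: cvg_cst.
  have cq (q : R -> R) l : q s @[s --> dot v n] --> l -> q (dot u n) @[u --> sphere_at] --> l.
    by move=> cq; apply: cvg_comp cq; exact: cvg_dot_sphere_at.
  have wnE : dot (w - dot w v *: v) n = - (sin t * dot w (meridian n v)).
    rewrite dotDl dotNl dotZl !(dot_meridian n1 hv) hv.1 (dotC v (meridian n v)).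
    by rewrite (meridian_orth n1 hv); ring.
  rewrite [X in _ --> X](_ : _ = ratio t *: (w - dot w v *: v)
    + (- (sin t * dot w (meridian n v)) * ((cos (g t) * g' t / sin t - sin (g t) * cos t / sin t ^+ 2) * - (sin t)^-1)) *: v
    + (- (sin t * dot w (meridian n v)) * ((cos (t - g t) * (1 - g' t) / sin t - sin (t - g t) * cos t / sin t ^+ 2) * - (sin t)^-1)) *: n).
    rewrite -wnE; apply: cvgD; first apply: cvgD.
    + by apply: cvgZ => //; exact: cvg_cst.
    + by apply: cvgZ => //; apply: cvgM => //; exact: cq.
    + by apply: cvgZ; [apply: cvgM => //; exact: cq|exact: cvg_cst].
  have nE B : B *: n = (B * cos t) *: v - (B * sin t) *: meridian n v.
    by rewrite {1}(normal_frame n1 hv) scalerBr !scalerA.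
  rewrite [_ *: n]nE /law_derivative -!addrA; congr (_ + _).
  move: (dot w (meridian n v)) => e0; rewrite /sin_ratio (negPf tn0).
  rewrite addrA -scalerDl -[- (_ *: meridian n v)]scaleNr; congr (_ *: _ + _ *: _).
    have -> : sin (t - g t) = sin t * cos (g t) - cos t * sin (g t) by exact: sinB.
    have -> : cos (t - g t) = cos t * cos (g t) + sin t * sin (g t) by exact: cosB.
    apply/eqP; rewrite -subr_eq0; apply/eqP.
    (* The two sides differ by a multiple of [cos t ^+ 2 + sin t ^+ 2 - 1]; with zero written in
       this form the identity is rational. *)
    have -> : 0 = (cos t ^+ 2 + sin t ^+ 2 - 1) *
      (g' t * cos (g t) / sin t - sin (g t) * cos t / sin t ^+ 2) * e0.
      by rewrite cs subrr !mul0r.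
    by field; rewrite gt_eqF.
  have -> : sin (t - g t) = sin t * cos (g t) - cos t * sin (g t) by exact: sinB.
  have -> : cos (t - g t) = cos t * cos (g t) + sin t * sin (g t) by exact: cosB.
  apply/eqP; rewrite -subr_eq0; apply/eqP.
  have -> : 0 = (cos t ^+ 2 + sin t ^+ 2 - 1) * (sin (g t) / sin t) * e0.
    by rewrite cs subrr !mul0r.
  by field; rewrite gt_eqF.
Qed.

End ReflectionDerivativeLimits.

(** * Pairs of vectors: norms, derivatives along a set, bundles *)

Section PhaseVectors.
Context {R : realType} {d : nat}.
Local Notation V := 'rV[R]_d.
Local Notation W := (V * V)%type.
Implicit Types (u w x y : W).

Lemma enorm_ge0 u : 0 <= enorm u. Proof. exact: sqrtr_ge0. Qed.

Lemma nrm_fst_le u : nrm u.1 <= enorm u.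
Proof. by rewrite /enorm ler_wsqrtr // lerDl dot_ge0. Qed.

Lemma nrm_snd_le u : nrm u.2 <= enorm u.
Proof. by rewrite /enorm ler_wsqrtr // lerDr dot_ge0. Qed.

Lemma enorm_le u : enorm u <= nrm u.1 + nrm u.2.
Proof.
have h := addr_ge0 (nrm_ge0 u.1) (nrm_ge0 u.2).
rewrite -(ger0_norm h) -sqrtr_sqr ler_wsqrtr // sqrrD -!sqr_nrm.
have := mulr_ge0 (nrm_ge0 u.1) (nrm_ge0 u.2); lra.
Qed.

Lemma enorm_fst (a : V) : enorm (a, 0) = nrm a.
Proof. by rewrite /enorm /nrm dot0l addr0. Qed.

Lemma enorm0 : enorm (0 : W) = 0.
Proof. by rewrite enorm_fst nrm0. Qed.

Lemma enorm_row_mx u : enorm u = nrm (row_mx u.1 u.2).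
Proof.
rewrite /enorm /nrm /dot big_split_ord /=; congr (Num.sqrt (_ + _)).
  by apply: eq_bigr => i _; rewrite row_mxEl.
by apply: eq_bigr => i _; rewrite row_mxEr.
Qed.

Lemma enormD u w : enorm (u + w) <= enorm u + enorm w.
Proof. by rewrite !enorm_row_mx -add_row_mx nrmD. Qed.

Lemma enormZ (k : R) u : enorm (k *: u) = `|k| * enorm u.
Proof.
rewrite /enorm /= !dotE -sqrtr_sqr -sqrtrM ?sqr_ge0 //; congr Num.sqrt; ring.
Qed.

Lemma enormN u : enorm (- u) = enorm u.
Proof. by rewrite -scaleN1r enormZ normrN1 mul1r. Qed.

Lemma enorm_sum (I : finType) (F : I -> W) :
  enorm (\sum_i F i) <= \sum_i enorm (F i).
Proof.
elim/big_rec2: _ => [|i y z _ h]; first by rewrite enorm0.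
by apply: (le_trans (enormD _ _)); rewrite lerD2l.
Qed.

Let basis (k : 'I_d + 'I_d) : W :=
  match k with inl i => (delta_mx 0 i, 0) | inr i => (0, delta_mx 0 i) end.
Let coeff u (k : 'I_d + 'I_d) : R :=
  match k with inl i => u.1 0 i | inr i => u.2 0 i end.

Lemma basis_decomposition u : u = \sum_k coeff u k *: basis k.
Proof.
rewrite big_sumType /=; case: u => a b /=.
have Z (I : Type) (r : seq I) (F : I -> W) :
    \sum_(i <- r) F i = (\sum_(i <- r) (F i).1, \sum_(i <- r) (F i).2).
  by elim/big_rec3: _ => // i y1 y2 y3 _ ->.
rewrite !Z /= [X in _ = _ + X](_ : _ = (0, b)); last first.
  congr pair; first by apply: big1 => i _; rewrite scaler0.
  by rewrite [RHS]row_sum_delta.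
rewrite [X in _ = X + _](_ : _ = (a, 0)); last first.
  congr pair; last by apply: big1 => i _; rewrite scaler0.
  by rewrite [RHS]row_sum_delta.
by congr pair; rewrite ?addr0 ?add0r.
Qed.

Lemma coeff_le u k : `|coeff u k| <= enorm u.
Proof.
case: k => i /=; apply: le_trans (coord_le_nrm _ i) _.
  exact: nrm_fst_le.
exact: nrm_snd_le.
Qed.

Lemma linear_enorm_le (T : W -> W) u : linear T ->
  enorm (T u) <= (\sum_k enorm (T (basis k))) * enorm u.
Proof.
move=> lT; pose T' : {linear W -> W} := HB.pack T (GRing.isLinear.Build R W W *:%R T lT).
have -> : T u = \sum_k coeff u k *: T (basis k).
  rewrite {1}(basis_decomposition u) -[T]/(GRing.Linear.sort T') linear_sum.
  by apply: eq_bigr => k _; rewrite linearZ.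
apply: (le_trans (enorm_sum _)); rewrite mulr_suml; apply: ler_sum => k _.
by rewrite enormZ mulrC ler_wpM2l ?enorm_ge0 ?coeff_le.
Qed.

(** In finite dimension pointwise convergence of linear maps is uniform on the unit ball: it is
    enough to control the basis vectors. *)
Lemma linear_cvg_enorm (Y : Type) (F : set_system Y) {FF : Filter F}
    (T : Y -> W -> W) (L : W -> W) :
  (\forall y \near F, linear (T y)) -> linear L ->
  (forall u, (T y u).1 @[y --> F] --> (L u).1) ->
  (forall u, (T y u).2 @[y --> F] --> (L u).2) ->
  forall e : R, 0 < e ->
  \forall y \near F, forall u, enorm (T y u - L u) <= e * enorm u.
Proof.
move=> lT lL c1 c2 e e0; pose N : R := (d + d).+1%:R.
have N0 : 0 < N by rewrite ltr0n.
have eN : 0 < e / N / 2 by rewrite !divr_gt0.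
have H k : \forall y \near F, enorm (T y (basis k) - L (basis k)) <= e / N.
  have /cvg_nrmP/(_ _ eN) h1 := c1 (basis k).
  have /cvg_nrmP/(_ _ eN) h2 := c2 (basis k).
  apply: filterS2 h1 h2 => y h1 h2; apply: (le_trans (enorm_le _)).
  by rewrite [leRHS]splitr; exact: lerD h1 h2.
apply: filterS2 lT (@filter_forall _ _ _ F FF H) => y lTy Hy u.
have lD : linear (fun u => T y u - L u).
  by move=> k w w'; rewrite lTy lL scalerBr opprD addrACA.
apply: (le_trans (linear_enorm_le u lD)); rewrite ler_wpM2r ?enorm_ge0 //.
apply: (@le_trans _ _ (\sum_(k : 'I_d + 'I_d) e / N)); first by apply: ler_sum => k _; exact: Hy.
rewrite sumr_const card_sum !card_ord -mulr_natr -mulrA ger_pMr //.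
by rewrite mulrC ler_pdivrMr // mul1r ler_nat.
Qed.

Lemma linfun_linear (T : W -> W) u : linear T -> linfun T u = T u.
Proof.
move=> lT; pose T' : {linear W -> W} := HB.pack T (GRing.isLinear.Build R W W *:%R T lT).
exact: (lfunE T').
Qed.

Lemma lfun_linear (L : 'End(W)) : linear L.
Proof. by move=> k u w; rewrite linearP. Qed.

(** If the increment is an exact value of linear maps [T y] that converge to [L], the remainder is
    [T y - L] applied to [y - x]. *)
Lemma is_derivative_of_increment (A : set W) (F : W -> W) x (T : W -> W -> W)
    (L : 'End(W)) :
  (forall y, linear (T y)) ->
  (\forall y \near within A (nbhs x), F y - F x = T y (y - x)) ->
  (forall u, (T y u).1 @[y --> within A (nbhs x)] --> (L u).1) ->
  (forall u, (T y u).2 @[y --> within A (nbhs x)] --> (L u).2) ->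
  is_derivative_along A F x L.
Proof.
move=> lT FT c1 c2 e e0.
have lT' : \forall y \near within A (nbhs x), linear (T y) by apply: filterE.
have H := linear_cvg_enorm lT' (@lfun_linear L) c1 c2 e0.
by apply: filterS2 FT (H _) => y -> h; exact: h.
Qed.

Lemma near_enorm (x : W) (e : R) : 0 < e -> \forall y \near x, enorm (y - x) < e.
Proof.
move=> e0; pose k : R := 2 * d%:R + 1; have k0 : 0 < k.
  by rewrite ltr_wpDl // mulr_ge0.
apply/nbhs_normP; exists (e / k); first by rewrite /= divr_gt0.
move=> y /=; rewrite distrC ltr_pdivlMr // => h; apply: le_lt_trans h.
apply: (le_trans (enorm_le _)).
have h1 : nrm (y - x).1 <= d%:R * `|y - x|.
  apply: (le_trans (nrm_le_norm _)); rewrite ler_wpM2l //.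
  by rewrite prod_normE /= le_max lexx.
have h2 : nrm (y - x).2 <= d%:R * `|y - x|.
  apply: (le_trans (nrm_le_norm _)); rewrite ler_wpM2l //.
  by rewrite prod_normE /= le_max lexx orbT.
by rewrite /k; have := normr_ge0 (y - x); lra.
Qed.

Lemma near_enormP (x : W) (Q : set W) : (\forall y \near x, Q y) ->
  exists2 e : R, 0 < e & forall y, enorm (y - x) < e -> Q y.
Proof.
move/nbhs_normP => [e /= e0 eQ]; exists e => // y ye; apply: eQ => /=.
rewrite distrC; apply: le_lt_trans ye; rewrite prod_normE ge_max.
apply/andP; split; apply: le_trans (norm_le_nrm _) _.
  exact: (nrm_fst_le (y - x)).
exact: (nrm_snd_le (y - x)).
Qed.

Lemma is_derivative_continuous (A : set W) (F : W -> W) x (L : 'End(W)) :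
  is_derivative_along A F x L ->
  exists2 c : R, 0 < c & \forall y \near within A (nbhs x),
    enorm (F y - F x) <= c * enorm (y - x).
Proof.
move=> dF; set k := \sum_k enorm (L (basis k)).
have k0 : 0 <= k by apply: sumr_ge0 => i _; exact: enorm_ge0.
exists (k + 1); first by rewrite ltr_wpDl.
apply: filterS (dF 1 ltr01) => y; rewrite mul1r => h.
have := enormD (F y - F x - L (y - x)) (L (y - x)); rewrite subrK.
have := linear_enorm_le (y - x) (@lfun_linear L); rewrite -/k; lra.
Qed.

Lemma is_derivative_comp (A B A' : set W) (F G : W -> W) x (L K : 'End(W)) :
  is_derivative_along A F x L -> is_derivative_along B G (F x) K ->
  (forall y, A' y -> A y /\ B (F y)) ->
  is_derivative_along A' (G \o F) x (K \o L)%VF.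
Proof.
move=> dF dG AB e e0.
have [c c0 Fc] := is_derivative_continuous dF.
set k := \sum_k enorm (K (basis k)).
have k0 : 0 <= k by apply: sumr_ge0 => i _; exact: enorm_ge0.
(* Half of [e] for the remainder of [G], taken at a distance up to [c] times larger, and half for
   the remainder of [F], enlarged by [K] at most [k] times. *)
have e1 : 0 < e / 2 / c by rewrite !divr_gt0.
have e2 : 0 < e / 2 / (k + 1) by rewrite !divr_gt0 // ltr_wpDl.
have [r r0 Gr] := near_enormP (dG _ e1).
have rc : 0 < r / c by rewrite divr_gt0.
have hF : \forall y \near x, A y ->
  enorm (F y - F x - L (y - x)) <= e / 2 / (k + 1) * enorm (y - x) := dF _ e2.
have {}Fc : \forall y \near x, A y -> enorm (F y - F x) <= c * enorm (y - x) := Fc.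
suff : \forall y \near x, A' y ->
  enorm ((G \o F) y - (G \o F) x - (K \o L)%VF (y - x)) <= e * enorm (y - x) by [].
apply: filterS3 hF Fc (near_enorm x rc) => y hF Fc yr A'y.
have [Ay BFy] := AB y A'y; have {}Fc := Fc Ay; have {}hF := hF Ay.
have Fr : enorm (F y - F x) < r.
  by apply: (le_lt_trans Fc); rewrite mulrC -ltr_pdivlMr.
have {Gr Fr BFy} hG := Gr (F y) Fr BFy.
rewrite comp_lfunE.
have -> : G (F y) - G (F x) - K (L (y - x)) =
    (G (F y) - G (F x) - K (F y - F x)) + K (F y - F x - L (y - x)).
  by rewrite (linearB K (F y - F x)) addrA subrK.
apply: (le_trans (enormD _ _)).
have hK := linear_enorm_le (F y - F x - L (y - x)) (@lfun_linear K).
have h1 : e / 2 / c * enorm (F y - F x) <= e / 2 * enorm (y - x).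
  by apply: (le_trans (ler_wpM2l (ltW e1) Fc)); rewrite mulrA divfK // gt_eqF.
have h2 : k * enorm (F y - F x - L (y - x)) <= e / 2 * enorm (y - x).
  apply: (@le_trans _ _ ((k + 1) * (e / 2 / (k + 1) * enorm (y - x)))).
    by apply: ler_pM; rewrite ?enorm_ge0 ?lerDl.
  by rewrite mulrA [(k + 1) * _]mulrC divfK // gt_eqF // ltr_wpDl.
by move: hK; rewrite -/k; lra.
Qed.

Lemma mem_limg_proj (Q : W -> W) u : linear Q -> (forall w, Q (Q w) = Q w) ->
  (u \in limg (linfun Q)) <-> Q u = u.
Proof.
move=> lQ QQ; split=> [/memv_imgP[w _ ->]|<-]; first by rewrite linfun_linear.
by rewrite -(linfun_linear u lQ) memv_img // memvf.
Qed.

(** For [u] in the range of [Q x], the vector [Q y u] lies in the range of [Q y] and differs from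
    [u = Q x u] by [(Q y - Q x) u]. *)
Lemma continuous_subspaces_proj (D : set W) (Q : W -> W -> W) :
  (forall x, D x -> linear (Q x)) ->
  (forall x, D x -> forall w, Q x (Q x w) = Q x w) ->
  (forall x, D x -> forall u, (Q y u).1 @[y --> within D (nbhs x)] --> (Q x u).1) ->
  (forall x, D x -> forall u, (Q y u).2 @[y --> within D (nbhs x)] --> (Q x u).2) ->
  continuous_subspaces D (fun x => limg (linfun (Q x))).
Proof.
move=> lQ QQ c1 c2 x Dx e e0.
have nearD : \forall y \near within D (nbhs x), D y by exact: withinT.
have lQ' : \forall y \near within D (nbhs x), linear (Q y) by apply: filterS nearD.
have H0 := linear_cvg_enorm lQ' (lQ x Dx) (c1 x Dx) (c2 x Dx) e0.
apply: filterS2 nearD (H0 _) => y Dy H; split=> u.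
  move=> /(mem_limg_proj _ (lQ x Dx) (QQ x Dx)) Qu; exists (Q y u).
    by apply/(mem_limg_proj _ (lQ y Dy) (QQ y Dy)); exact: QQ.
  by rewrite -enormN opprB -{2}Qu; exact: H.
move=> /(mem_limg_proj _ (lQ y Dy) (QQ y Dy)) Qu; exists (Q x u).
  by apply/(mem_limg_proj _ (lQ x Dx) (QQ x Dx)); exact: QQ.
by rewrite -{1}Qu; exact: H.
Qed.

End PhaseVectors.

(** * The billiard map near a point of its domain *)

Section LocalDynamics.
Context {R : realType} {d : nat}.
Local Notation V := 'rV[R]_d.
Local Notation W := (V * V)%type.
Variables (P : set V) (f : R -> R).
Hypotheses (polyP : is_polytope P) (dimP : has_dim P d).
Implicit Types (p q n v : V) (x y : W).
Local Notation M := (phase_space P).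
Local Notation M' := (billiard_domain P).
Local Notation Phi := (billiard_map f P).

Definition facet_normal_at p : V := xget 0 [set n | flat P p n].

Lemma polytope_flat_unique p n n' : flat P p n -> flat P p n' -> n = n'.
Proof. by have [m [a [c [_ PE _]]]] := polytope_irredundant polyP; exact: (flat_unique PE). Qed.

Lemma facet_normal_atE p n : flat P p n -> facet_normal_at p = n.
Proof. by move=> fl; apply: xget_unique => // n' fl'; exact: polytope_flat_unique fl' fl. Qed.

Lemma flat_near q n : flat P q n ->
  \forall z \near q, dot z n = dot q n -> flat P z n.
Proof.
move=> [n1 nearq]; have /near_nrm[r r0 rP] := nearq.
apply/near_nrm; exists (r / 2) => [|z zr zq]; first by rewrite divr_gt0.
split => //; apply/near_nrm; exists (r / 2) => [|y yr]; first by rewrite divr_gt0.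
rewrite zq; apply: rP; rewrite -(subrK z y) -addrA.
by apply: (le_lt_trans (nrmD _ _)); lra.
Qed.

(** A flat point of [P] close to [p] lies either on the hyperplane through [p], where the normal is
    [n], or strictly inside the half-space; the latter makes it interior to [P], which is
    impossible. *)
Lemma near_flat_normal p n : flat P p n ->
  \forall y \near p, forall m, flat P y m -> m = n.
Proof.
move=> fl; have := flat_near fl; have [n1 nearp] := fl.
have /near_nrm[r r0 rP] := nearp => nearfl.
have near1 : \forall y \near p, nrm (y - p) < r by apply/near_nrm; exists r.
apply: filterS2 near1 nearfl => y yr flz m flm.
have Py : P y := flat_mem flm.
have := (rP y yr).1 Py; rewrite le_eqVlt => /orP[/eqP/esym/flz fly|lt].
  exact: polytope_flat_unique flm fly.
have int : \forall z \near y, P z.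
  have nz : \forall z \near y, dot p n < dot z n.
    have := @dot_continuous R d n y; move/cvgr_gt; exact.
  have rz : \forall z \near y, nrm (z - p) < r.
    apply/near_nrm; exists (r - nrm (y - p)) => [|z zy]; first by rewrite subr_gt0.
    rewrite -(subrK y z) -addrA; apply: (le_lt_trans (nrmD _ _)).
    by rewrite -ltrBrDr.
  by apply: filterS2 nz rz => z zn zr; apply/rP => //; exact: ltW.
have [m1 nearm] := flm.
have nearm' : \forall z \near y, dot y m <= dot z m by apply: filterS2 int nearm => z Pz [+ _]; exact.
have [t t0 H] := near_line nearm' m.
have := H (- t); rewrite normrN (gtr0_norm t0) lexx => /(_ isT).
by rewrite dotDl dotZl m1 mulr1 lerDl oppr_ge0 leNgt t0.
Qed.

Lemma near_facet_normal_at p n : flat P p n -> \forall y \near p,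
  (exists m, flat P y m) -> facet_normal_at y = n /\ flat P y n.
Proof.
move=> fl; apply: filterS (near_flat_normal fl) => y H [m flm].
by rewrite -(H m flm); split=> //; exact: facet_normal_atE.
Qed.

Lemma phase_space_flat x : M x <-> exists n, flat P x.1 n /\ hemisphere n x.2.
Proof.
by have [m [a [c [a0 PE _]]]] := polytope_irredundant polyP; exact: phase_spaceE a0 PE dimP x.
Qed.

Lemma phase_space_normal x : M x ->
  flat P x.1 (facet_normal_at x.1) /\ hemisphere (facet_normal_at x.1) x.2.
Proof. by move=> /phase_space_flat[n [fl hv]]; rewrite (facet_normal_atE fl). Qed.

Lemma billiard_tangent_normal x h : M x -> billiard_tangent P x h <->
  dot h.1 (facet_normal_at x.1) = 0 /\ dot h.2 x.2 = 0.
Proof.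
move=> /phase_space_normal[fl _].
have [m [a [c [a0 PE _]]]] := polytope_irredundant polyP.
have E := billiard_tangentE a0 PE dimP x h; split=> [/E[n [fln h1 h2]]|[h1 h2]].
  by rewrite (facet_normal_atE fln).
by apply/E; exists (facet_normal_at x.1).
Qed.

Lemma reflect_normal_dot n v : dot n n = 1 -> dot (reflect_normal n v) n = - dot v n.
Proof. by move=> n1; rewrite !dotE n1; ring. Qed.

Lemma reflect_normal_isometry n v w : dot n n = 1 ->
  dot (reflect_normal n v) (reflect_normal n w) = dot v w.
Proof. by move=> n1; rewrite !dotE n1 (dotC n w); ring. Qed.

Lemma reflect_normal_linear n : linear (reflect_normal n).
Proof.
move=> k u w; rewrite /reflect_normal dotDl dotZl.
by apply/rowP => i; rewrite !mxE; ring.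
Qed.

Lemma reflect_normalB n v w :
  reflect_normal n (v - w) = reflect_normal n v - reflect_normal n w.
Proof.
rewrite /reflect_normal dotDl dotNl.
by apply/rowP => i; rewrite !mxE; ring.
Qed.

Lemma reflect_normal_hemisphere n v : dot n n = 1 -> dot v v = 1 -> dot v n < 0 ->
  hemisphere n (reflect_normal n v).
Proof.
by move=> n1 v1 vn; split; rewrite ?reflect_normal_isometry // reflect_normal_dot // oppr_gt0.
Qed.

(** As the velocity is a unit vector, this is the [tau] of the step; continuity is then inherited
    from that of [Phi]. *)
Definition flight_time x : R := dot ((Phi x).1 - x.1) x.2.

Lemma billiard_domain_map x : M' x ->
  let n := facet_normal_at (Phi x).1 in
  [/\ 0 < flight_time x, (Phi x).1 = x.1 + flight_time x *: x.2,
    flat P (Phi x).1 n, dot x.2 n < 0 &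
    (Phi x).2 = contracting_law f n (reflect_normal n x.2)].
Proof.
move=> M'x; have [n [n' [T [fl hv T0 fl' PhiE]]]] := billiard_domain_hit f polyP dimP M'x.
have nE : facet_normal_at (Phi x).1 = n' by rewrite PhiE; exact: facet_normal_atE.
have TE : flight_time x = T.
  by rewrite /flight_time PhiE /= addrC addKr dotZl hv.1 mulr1.
rewrite /= nE TE PhiE /=; split => //.
have [m [a [c [a0 PE _]]]] := polytope_irredundant polyP.
exact: (flow_transversal a0 PE fl hv.2 T0 fl').
Qed.

(** The time at which the line of [y] meets the hyperplane through [q] with normal [n], whether or
    not this is a collision. *)
Definition hit_time (q n : V) y : R := dot (q - y.1) n / dot y.2 n.

(* Orbits close to that of [x] next hit the same facet. *)
Lemma billiard_map_near x q n (T : R) : 0 < T -> q = x.1 + T *: x.2 ->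
  flat P q n -> dot x.2 n < 0 ->
  \forall y \near within M (nbhs x),
    Phi y = (y.1 + hit_time q n y *: y.2,
             contracting_law f n (reflect_normal n y.2)) /\
    facet_normal_at (Phi y).1 = n.
Proof.
move=> T0 qE fl vn.
set F := within M (nbhs x).
have c1 : y.1 @[y --> F] --> x.1 by apply: cvg_within_filter; exact: cvg_fst.
have c2 : y.2 @[y --> F] --> x.2 by apply: cvg_within_filter; exact: cvg_snd.
have ch : hit_time q n y @[y --> F] --> T.
  have -> : T = dot (q - x.1) n / dot x.2 n.
    by rewrite qE addrC addKr dotZl mulfK // lt_eqF.
  apply: cvgM.
    by apply: cvg_dot; [apply: cvgB => //; exact: cvg_cst|exact: cvg_cst].
  by apply: cvgV; [rewrite lt_eqF|apply: cvg_dot => //; exact: cvg_cst].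
have cq : y.1 + hit_time q n y *: y.2 @[y --> F] --> q.
  by rewrite [X in _ --> X]qE; apply: cvgD => //; exact: cvgZ.
have nearM : \forall y \near F, M y by exact: withinT.
have nearT : \forall y \near F, 0 < hit_time q n y by move/cvgr_gt : ch; exact.
have nearn : \forall y \near F, dot y.2 n < 0.
  have : dot y.2 n @[y --> F] --> dot x.2 n by apply: cvg_dot => //; exact: cvg_cst.
  by move/cvgr_lt; exact.
have nearfl : \forall y \near F, flat P (y.1 + hit_time q n y *: y.2) n.
  have := cq _ (flat_near fl); apply: filterS2 nearn => y yn; apply.
  rewrite dotDl dotZl /hit_time divfK ?lt_eqF // !dotE; ring.
apply: filterS3 nearM nearT nearfl => y My yT yfl.
have /phase_space_normal[fly hvy] := My.
have [m [a [c [a0 PE _]]]] := polytope_irredundant polyP.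
have := flow_hit a0 PE dimP f fly hvy.2 yT yfl; rewrite -surjective_pairing => E.
by split; rewrite ?E //; exact: facet_normal_atE.
Qed.

Lemma billiard_map_local x : M' x ->
  let n := facet_normal_at (Phi x).1 in
  \forall y \near within M (nbhs x),
    Phi y = (y.1 + hit_time (Phi x).1 n y *: y.2,
             contracting_law f n (reflect_normal n y.2)) /\
    facet_normal_at (Phi y).1 = n.
Proof.
by move=> M'x n; have [T0 qE fl vn _] := billiard_domain_map M'x; exact: billiard_map_near qE fl vn.
Qed.

Lemma polytope_diam : exists2 B : R, 0 <= B &
  forall x, M' x -> `|flight_time x| <= B.
Proof.
have [B B0 PB] := compact_nrm_bounded polyP.1.
exists (B + B) => [|x M'x]; first by rewrite addr_ge0.
have [_ _ fl _ _] := billiard_domain_map M'x.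
have [fl0 hv] := phase_space_normal M'x.1.
apply: (le_trans (normr_dot_le _ _)); rewrite (nrm_unit hv.1) mulr1.
by apply: (le_trans (nrmB _ _)); rewrite lerD // PB //; apply: flat_mem; eassumption.
Qed.

End LocalDynamics.

(** * Limits of sequences with geometric increments *)

Section GeometricLimit.
Context {R : realType} {d : nat}.
Local Notation V := 'rV[R]_d.

Lemma cvg_row_unique (u : nat -> V) (l l' : V) :
  u N @[N --> \oo] --> l -> u N @[N --> \oo] --> l' -> l = l'.
Proof.
move=> /cvg_rowP ul /cvg_rowP ul'; apply/rowP => i.
by rewrite -(cvg_lim _ (ul i)) // -(cvg_lim _ (ul' i)).
Qed.

(** Keeping the subtracted power makes the bound the exact geometric sum, so the induction step is
    an identity. *)
Lemma geometric_telescope (u : nat -> V) (c mu : R) : 0 < mu < 1 ->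
  (forall N, nrm (u N.+1 - u N) <= c * mu ^+ N) ->
  forall k N, nrm (u (N + k)%N - u N) <= c / (1 - mu) * (mu ^+ N - mu ^+ (N + k)).
Proof.
move=> /andP[mu0 mu1] H k N; have mu1' : 1 - mu != 0 by rewrite subr_eq0 gt_eqF.
elim: k => [|k IH]; first by rewrite addn0 !subrr nrm0 mulr0.
rewrite -(subrK (u (N + k)%N) (u (N + k.+1)%N)) -addrA.
apply: (le_trans (nrmD _ _)); rewrite addnS.
apply: (le_trans (lerD (H _) IH)).
rewrite [in leRHS]exprS le_eqVlt; apply/orP; left; apply/eqP.
by field.
Qed.

Lemma geometric_limit (u : nat -> V) (c mu : R) : 0 <= c -> 0 < mu < 1 ->
  (forall N, nrm (u N.+1 - u N) <= c * mu ^+ N) ->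
  exists l : V, u N @[N --> \oo] --> l /\
    forall N, nrm (l - u N) <= c / (1 - mu) * mu ^+ N.
Proof.
move=> c0 mu01 H; have /andP[mu0 mu1] := mu01.
have cm0 : 0 <= c / (1 - mu) by rewrite divr_ge0 // subr_ge0 ltW.
have tail N k : nrm (u (N + k)%N - u N) <= c / (1 - mu) * mu ^+ N.
  apply: (le_trans (geometric_telescope mu01 H k N)).
  by rewrite ler_wpM2l // gerBl exprn_ge0 // ltW.
have cmu : c / (1 - mu) * mu ^+ N @[N --> \oo] --> 0.
  rewrite -(mulr0 (c / (1 - mu))); apply: cvgM; first exact: cvg_cst.
  by apply: cvg_expr; rewrite gtr0_norm.
have coordcvg i : cvgn (fun N => u N 0 i).
  apply/cauchy_cvgP/cauchyP => e e0.
  move/cvgrPdist_lt : cmu => /(_ e e0)[N _ HN]; exists (u N 0 i).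
  exists N => // m /= Nm; rewrite /ball /= distrC.
  have := HN N (leqnn N); rewrite /= sub0r normrN ger0_norm; last first.
    by rewrite mulr_ge0 // exprn_ge0 // ltW.
  apply: le_lt_trans; rewrite -(subnKC Nm); apply: le_trans (tail N (m - N)%N).
  by have := coord_le_nrm (u (N + (m - N))%N - u N) i; rewrite !mxE.
exists (\row_i limn (fun N => u N 0 i)).
have cu : u N @[N --> \oo] --> (\row_i limn (fun N => u N 0 i) : V).
  by apply/cvg_rowP => i; rewrite mxE; exact: coordcvg.
split => // N.
have cn : nrm (u m - u N) @[m --> \oo] -->
    nrm ((\row_i limn (fun N => u N 0 i) : V) - u N).
  by apply: cvg_nrm; apply: cvgB => //; exact: cvg_cst.
rewrite -(cvg_lim _ cn) //; apply: limr_le; first by apply/cvg_ex; eexists; exact: cn.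
by exists N => // m /= Nm; rewrite -(subnKC Nm); exact: tail.
Qed.

End GeometricLimit.

(** * Oblique projections onto hyperplanes *)

Section ObliqueProjection.
Context {R : realType} {d : nat}.
Local Notation V := 'rV[R]_d.
Implicit Types (n u v w : V).

Definition oblique n v u : V := u - (dot u n / dot v n) *: v.

Lemma oblique_linear n v : linear (oblique n v).
Proof.
move=> k u w; rewrite /oblique dotDl dotZl.
by apply/rowP => i; rewrite !mxE; ring.
Qed.

Lemma oblique_orth n v u : dot v n != 0 -> dot (oblique n v u) n = 0.
Proof. by move=> vn; rewrite dotDl dotNl dotZl divfK // subrr. Qed.

Lemma oblique_id n v u : dot u n = 0 -> oblique n v u = u.
Proof. by move=> un; rewrite /oblique un mul0r scale0r subr0. Qed.

Lemma obliqueD n v u (k : R) : dot v n != 0 ->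
  oblique n v (u + k *: v) = oblique n v u.
Proof.
move=> vn; rewrite /oblique dotDl dotZl; apply/rowP => i; rewrite !mxE; field.
exact: vn.
Qed.

Lemma obliqueB n v u (k : R) : dot v n != 0 ->
  oblique n v (u - k *: v) = oblique n v u.
Proof. by move=> vn; rewrite -scaleNr obliqueD. Qed.

Lemma oblique_cvg (Y : Type) (F : set_system Y) {FF : Filter F} n (v : Y -> V) v0 u :
  dot v0 n != 0 -> v y @[y --> F] --> v0 ->
  oblique n (v y) u @[y --> F] --> oblique n v0 u.
Proof.
move=> vn cv; apply: cvgB; first exact: cvg_cst.
apply: cvgZ => //; apply: cvgM; first exact: cvg_cst.
by apply: cvgV => //; apply: cvg_dot => //; exact: cvg_cst.
Qed.

Lemma linear_cvg_comp (Y : Type) (F : set_system Y) {FF : Filter F}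
    (T : Y -> V -> V) (L : V -> V) (z : Y -> V) z0 :
  (\forall y \near F, linear (T y)) -> linear L ->
  (forall u, T y u @[y --> F] --> L u) -> z y @[y --> F] --> z0 ->
  T y (z y) @[y --> F] --> L z0.
Proof.
move=> lT lL cT cz.
have expand (S : V -> V) u : linear S -> S u = \sum_i u 0 i *: S (delta_mx 0 i).
  move=> lS; pose S' : {linear V -> V} := HB.pack S (GRing.isLinear.Build R V V *:%R S lS).
  rewrite {1}(row_sum_delta u) -[S]/(GRing.Linear.sort S') linear_sum.
  by apply: eq_bigr => k _; rewrite linearZ.
have c : (\sum_i z y 0 i *: T y (delta_mx 0 i)) @[y --> F] --> L z0.
  rewrite (expand L) //; apply: cvg_big => [|i _]; first exact: add_continuous.
  by apply: cvgZ => //; move/cvg_rowP : cz; exact.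
apply: cvg_trans c; apply: near_eq_cvg.
by apply: filterS lT => y lTy; rewrite -expand.
Qed.

Lemma cvg_within_sphere (Y : Type) (F : set_system Y) {FF : Filter F} (h : Y -> V) v :
  (\forall y \near F, dot (h y) (h y) = 1) -> h y @[y --> F] --> v ->
  h y @[y --> F] --> within [set u : V | dot u u = 1] (nbhs v).
Proof.
move=> h1 hv Q Qv; have := hv _ Qv; apply: filterS2 h1 => y hy; exact.
Qed.

End ObliqueProjection.

(** * Skew products over the velocity: the derivative *)

Section SkewProduct.
Context {R : realType} {d : nat}.
Local Notation V := 'rV[R]_d.
Local Notation W := (V * V)%type.
Context (lam : R) (f g g' : R -> R) (mu : R).
Hypotheses (lawE : law_extension lam f g g') (mu01 : 0 < mu < 1)
  (g'_le : forall t, t < pi / 2 -> `|g' t| <= mu)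
  (ratio_le : forall t, 0 <= t < pi / 2 -> `|sin_ratio g g' t| <= mu).
Variables (M M' : set W) (Phi : W -> W) (nu : W -> V) (B : R).
Local Notation tau x := (dot ((Phi x).1 - x.1) x.2).
Local Notation nu' x := (nu (Phi x)).
Hypotheses (M'M : M' `<=` M)
  (nuM : forall x, M x -> dot (nu x) (nu x) = 1 /\ hemisphere (nu x) x.2)
  (near_nu : forall x, M x -> \forall y \near within M (nbhs x), nu y = nu x)
  (step : forall x, M' x ->
    [/\ (Phi x).1 = x.1 + tau x *: x.2, dot (nu' x) (nu' x) = 1,
      dot x.2 (nu' x) < 0 &
      (Phi x).2 = contracting_law f (nu' x) (reflect_normal (nu' x) x.2)])
  (near_step : forall x, M' x -> \forall y \near within M (nbhs x),
    Phi y = (y.1 + hit_time (Phi x).1 (nu' x) y *: y.2,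
             contracting_law f (nu' x) (reflect_normal (nu' x) y.2)) /\
    nu' y = nu' x)
  (B_ge0 : 0 <= B) (tau_le : forall x, M' x -> `|tau x| <= B).
Implicit Types (x y : W) (u v w : V).

Definition incidence x : V := reflect_normal (nu' x) x.2.

Definition velocity_derivative x w : V :=
  law_derivative g g' (nu' x) (incidence x) (reflect_normal (nu' x) w).

(** [h.1 + tau x *: h.2] is the displacement after the fixed time [tau x]; projecting along the
    velocity accounts for the change of the collision time. *)
Definition map_derivative x (h : W) : W :=
  (oblique (nu' x) x.2 (h.1 + tau x *: h.2), velocity_derivative x h.2).

(** The inverse of the derivative on tangent positions: projection along the same velocity, back
    onto the facet of departure. *)
Definition pull_back x u : V := oblique (nu x) x.2 u.

Lemma incidence_hemisphere x : M' x -> hemisphere (nu' x) (incidence x).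
Proof.
move=> M'x; have [_ n1 vn _] := step M'x; have [_ [v1 _]] := nuM (M'M M'x).
exact: reflect_normal_hemisphere.
Qed.

Lemma velocity_derivative_linear x : linear (velocity_derivative x).
Proof.
by move=> k u w; rewrite /velocity_derivative reflect_normal_linear law_derivative_linear.
Qed.

Lemma map_derivative_linear x : linear (map_derivative x).
Proof.
move=> k u w; rewrite /map_derivative /= velocity_derivative_linear.
congr pair; rewrite -oblique_linear; congr oblique.
by apply/rowP => i; rewrite !mxE; ring.
Qed.

Lemma velocity_derivative_le x w : M' x ->
  nrm (velocity_derivative x w) <= mu * nrm w.
Proof.
move=> M'x; have [_ n1 _ _] := step M'x; have hv := incidence_hemisphere M'x.
have /andP[mu0 _] := mu01; have tI := angleI n1 hv.
have -> : nrm w = nrm (reflect_normal (nu' x) w).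
  by rewrite /nrm reflect_normal_isometry.
apply: law_derivative_le => //; first exact: ltW.
  by apply: g'_le; have /andP[] := tI.
exact: ratio_le.
Qed.

Lemma velocity_derivative_tangent x w : M' x ->
  dot (velocity_derivative x w) (Phi x).2 = 0.
Proof.
move=> M'x; have [_ n1 _ ->] := step M'x.
exact: (law_derivative_tangent lawE n1 (incidence_hemisphere M'x)).
Qed.

Lemma velocity_derivative_radial x : M' x -> velocity_derivative x x.2 = 0.
Proof.
move=> M'x; have [_ n1 _ _] := step M'x.
exact: (law_derivative_radial g g' n1 (incidence_hemisphere M'x)).
Qed.

Lemma phase_unit x : M x -> dot x.2 x.2 = 1.
Proof. by move=> /nuM[_ []]. Qed.

Lemma phase_transversal x : M x -> dot x.2 (nu x) != 0.
Proof. by move=> /nuM[_ [_ h]]; rewrite gt_eqF. Qed.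

Lemma near_phase x : \forall y \near within M (nbhs x), M y.
Proof. exact: withinT. Qed.

Lemma cvg_position x : y.1 @[y --> within M (nbhs x)] --> x.1.
Proof. by apply: cvg_within_filter; exact: cvg_fst. Qed.

Lemma cvg_velocity x : y.2 @[y --> within M (nbhs x)] --> x.2.
Proof. by apply: cvg_within_filter; exact: cvg_snd. Qed.

Lemma cvg_incidence x : M' x ->
  reflect_normal (nu' x) y.2 @[y --> within M (nbhs x)] -->
  within [set u : V | dot u u = 1] (nbhs (incidence x)).
Proof.
move=> M'x; have [_ n1 _ _] := step M'x; apply: cvg_within_sphere.
  by apply: filterS (near_phase x) => y /phase_unit; rewrite reflect_normal_isometry.
apply: cvgB; first exact: cvg_velocity.
apply: cvgZ; last exact: cvg_cst.
apply: cvgM; first exact: cvg_cst.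
by apply: cvg_dot; [exact: cvg_velocity|exact: cvg_cst].
Qed.

Lemma is_derivative_step x : M' x ->
  is_derivative_along M Phi x (linfun (map_derivative x)).
Proof.
move=> M'x; have [qE n1 vn _] := step M'x; have hv := incidence_hemisphere M'x.
have [T [lT TE cT]] := contracting_law_increment lawE n1 hv.
apply: (is_derivative_of_increment (T := fun y h =>
  (oblique (nu' x) y.2 (h.1 + tau x *: h.2),
   T (reflect_normal (nu' x) y.2) (reflect_normal (nu' x) h.2)))).
- move=> y k h h' /=; rewrite reflect_normal_linear lT; congr pair.
  rewrite -oblique_linear; congr oblique.
  by apply/rowP => i; rewrite !mxE; ring.
- have near_vn : \forall y \near within M (nbhs x), dot y.2 (nu' x) < 0.
    have : dot y.2 (nu' x) @[y --> within M (nbhs x)] --> dot x.2 (nu' x).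
      by apply: cvg_dot; [exact: cvg_velocity|exact: cvg_cst].
    by move/cvgr_lt; exact.
  have nearT := cvg_incidence M'x TE.
  apply: filterS3 near_vn nearT (near_step M'x) => y yn yT [PhiE _].
  rewrite PhiE; apply: injective_projections => /=; last first.
    by have [_ _ _ ->] := step M'x; rewrite reflect_normalB; exact: yT.
  have yn0 : dot y.2 (nu' x) != 0 by rewrite lt_eqF.
  (* Up to a multiple of [y.2], killed by the projection along [y.2], the displacement is
     [y.1 - (Phi x).1]. The formula for the increment is therefore exact. *)
  have -> : y.1 - x.1 + tau x *: (y.2 - x.2) = (y.1 - (Phi x).1) + tau x *: y.2.
    by move: (tau x) qE => s ->; apply/rowP => i; rewrite !mxE; ring.
  rewrite obliqueD // /oblique /hit_time -addrA [_ *: y.2 - _]addrC addrA -scaleNr.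
  congr (_ + _ *: _); rewrite -mulNr -dotNl opprB //.
- move=> u; rewrite linfun_linear; last exact: map_derivative_linear.
  by apply: oblique_cvg; [rewrite lt_eqF|exact: cvg_velocity].
- move=> u; rewrite linfun_linear; last exact: map_derivative_linear.
  exact: cvg_comp (cvg_incidence M'x) (cT _).
Qed.

Fixpoint iterate_derivative (n : nat) x : 'End(W) :=
  if n is k.+1 then
    (linfun (map_derivative (iter k Phi x)) \o iterate_derivative k x)%VF
  else \1%VF.

Lemma is_derivative_iterate n x : (forall k, M' (iter k Phi x)) ->
  is_derivative_along (iter_domain M M' Phi n) (iter n Phi) x (iterate_derivative n x).
Proof.
move=> M'x; elim: n => [|n IH] /=.
  move=> e e0; apply: filterE => y; rewrite id_lfunE subrr enorm0.
  by rewrite mulr_ge0 ?enorm_ge0 // ltW.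
apply: is_derivative_comp IH (is_derivative_step (M'x n)) _ => y [My M'y].
split; last exact/M'M/M'y.
by split => // k kn; apply: M'y; rewrite ltnW.
Qed.

(** * The invariant domain and norms on positions *)

Local Notation D := (invariant_domain M M' Phi).

Lemma invariant_forward x n : D x -> M' (iter n Phi x).
Proof. by move=> /(_ 0%N)[y [_ M'y] <-] /=. Qed.

Lemma invariant_M' x : D x -> M' x.
Proof. by move=> Dx; exact: (invariant_forward 0 Dx). Qed.

Lemma invariant_M x : D x -> M x.
Proof. by move=> /invariant_M'/M'M. Qed.

Lemma invariant_map x : D x -> D (Phi x).
Proof.
move=> Dx n; have [y [My M'y] <-] := Dx n; exists (Phi y); last by rewrite -iterSr.
split; first exact/M'M/(M'y 1%N).
by move=> k; rewrite -iterSr; exact: M'y.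
Qed.

Lemma invariant_iter x n : D x -> D (iter n Phi x).
Proof. by move=> Dx; elim: n => //= n; exact: invariant_map. Qed.

(** The definition of [D] at [n = 1] provides a preimage, so the velocity is a value of the law, at
    an angle of at most [lam * (pi / 2)] from the normal. *)
Lemma invariant_angle x : D x -> law_cos_min lam <= dot x.2 (nu x).
Proof.
move=> /(_ 1%N)[y [_ M'y] /= <-]; have M'y0 := M'y 0%N.
have [_ n1 _ ->] := step M'y0; have hv := incidence_hemisphere M'y0.
rewrite (dot_contracting_law lawE n1 hv).
exact: (law_cos_min_le lawE (angleI n1 hv)).
Qed.

(* The squared norm of the component of [u] orthogonal to the velocity. On
   positions tangent to a facet it is equivalent to the squared norm, and
   [pull_back] does not increase it. *)
Definition transverse_sq x u : R := dot u u - dot u x.2 ^+ 2.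

(** Adding multiples of [x.2] does not change the part orthogonal to [x.2]. Passing from the
    incoming to the outgoing velocity multiplies the inner product with [u] by the ratio, of modulus
    at most 1, so less is subtracted after the collision. *)
Lemma transverse_sq_pull_back x u : M' x -> dot u (nu' x) = 0 ->
  transverse_sq x (pull_back x u) <= transverse_sq (Phi x) u.
Proof.
move=> M'x un; have [_ n1 _ PhiE] := step M'x; have hv := incidence_hemisphere M'x.
have v1 := phase_unit (M'M M'x).
have -> : transverse_sq x (pull_back x u) = transverse_sq x u.
  rewrite /transverse_sq /pull_back /oblique; move: (_ / _) => k.
  by rewrite !dotE v1 (dotC x.2 u); ring.
rewrite lerD2l lerN2 PhiE (dot_contracting_law_orth lawE n1 hv un) exprMn.
have -> : dot u (reflect_normal (nu' x) x.2) = dot u x.2.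
  by rewrite !dotE un mulr0 subr0.
have h := ratio_le (angleI n1 hv); have /andP[mu0 mu1] := mu01.
have h1 : sin_ratio g g' (angle (nu' x) (incidence x)) ^+ 2 <= 1.
  by rewrite -real_normK ?num_real // expr_le1 // (le_trans h) // ltW.
by rewrite ler_piMl ?sqr_ge0.
Qed.

(** A position tangent to the facet sees only the tangential part of the velocity, of squared norm
    at most [1 - law_cos_min lam ^+ 2]; the bound follows by Cauchy-Schwarz. *)
Lemma transverse_sq_ge x u : D x -> dot u (nu x) = 0 ->
  law_cos_min lam ^+ 2 * dot u u <= transverse_sq x u.
Proof.
move=> Dx un; have [n1 [v1 vn]] := nuM (invariant_M Dx).
have k0 := law_cos_min_gt0 lawE; have kv := invariant_angle Dx.
have E : dot u x.2 = dot u (x.2 - dot x.2 (nu x) *: nu x).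
  by rewrite !dotE un mulr0 subr0.
have := dot_sqr_le u (x.2 - dot x.2 (nu x) *: nu x); rewrite -E /transverse_sq.
have -> : dot (x.2 - dot x.2 (nu x) *: nu x) (x.2 - dot x.2 (nu x) *: nu x) =
    1 - dot x.2 (nu x) ^+ 2 by rewrite !dotE v1 n1 (dotC (nu x)); ring.
have : law_cos_min lam ^+ 2 <= dot x.2 (nu x) ^+ 2.
  by rewrite ler_pXn2r ?nnegrE // ltW.
by have := dot_ge0 u; nra.
Qed.

Lemma nrm_le_transverse x u (c : R) : D x -> dot u (nu x) = 0 -> 0 <= c ->
  transverse_sq x u <= c ^+ 2 -> nrm u <= c / law_cos_min lam.
Proof.
move=> Dx un c0 uc; have k0 := law_cos_min_gt0 lawE.
have ck : 0 <= c / law_cos_min lam by rewrite divr_ge0 // ltW.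
rewrite (nrm_le _ ck) expr_div_n ler_pdivlMr ?exprn_gt0 //.
by rewrite mulrC; apply: le_trans uc; exact: transverse_sq_ge.
Qed.

(* Partial sums of the graph transform whose fixed point is the stable
   bundle. *)
Fixpoint stable_approx (N : nat) x w : V :=
  if N is k.+1 then
    pull_back x (stable_approx k (Phi x) (velocity_derivative x w) - tau x *: w)
  else 0.

Lemma pull_back_linear x : linear (pull_back x).
Proof. exact: oblique_linear. Qed.

Lemma stable_approx_linear N x : linear (stable_approx N x).
Proof.
elim: N x => [|N IH] x k u w /=; first by rewrite scaler0 addr0.
rewrite velocity_derivative_linear IH -pull_back_linear; congr pull_back.
by apply/rowP => i; rewrite !mxE; ring.
Qed.

Lemma pull_backB x u w : pull_back x u - pull_back x w = pull_back x (u - w).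
Proof. by rewrite addrC -scaleN1r -pull_back_linear scaleN1r addrC. Qed.

Lemma stable_approx_orth N x w : M x -> dot (stable_approx N x w) (nu x) = 0.
Proof.
move=> Mx; case: N => [|N] /=; first by rewrite dot0l.
by apply: oblique_orth; exact: phase_transversal.
Qed.

(** The flight term cancels in consecutive differences, which are thus pulled back from the next
    point. Each collision gains [mu] from the velocity derivative and loses nothing in the
    pull-back; the first difference is bounded by the flight time. *)
Lemma stable_approx_step N x w : D x ->
  transverse_sq x (stable_approx N.+1 x w - stable_approx N x w) <=
  (B * mu ^+ N * nrm w) ^+ 2.
Proof.
have /andP[mu0 mu1] := mu01.
elim: N x w => [|N IH] x w Dx; have M'x := invariant_M' Dx.
  rewrite /= expr0 mulr1 !sub0r subr0 -scaleNr.
  have v1 := phase_unit (M'M M'x).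
  have -> : transverse_sq x (pull_back x (- tau x *: w)) = tau x ^+ 2 * transverse_sq x w.
    rewrite /transverse_sq /pull_back /oblique; move: (tau x) => s; move: (_ / _) => k.
    by rewrite !dotE v1 (dotC x.2 w); ring.
  rewrite exprMn sqr_nrm; apply: ler_pM; rewrite ?sqr_ge0 //.
  - by rewrite subr_ge0; have := dot_sqr_le w x.2; rewrite v1 mulr1.
  - by rewrite -(real_normK (num_real (tau x))) ler_pXn2r ?nnegrE // tau_le.
  - by rewrite gerBl sqr_ge0.
have -> : stable_approx N.+2 x w - stable_approx N.+1 x w = pull_back x
    (stable_approx N.+1 (Phi x) (velocity_derivative x w) -
     stable_approx N (Phi x) (velocity_derivative x w)).
  rewrite [stable_approx N.+2 x w]/= [in X in _ - X = _]/= pull_backB.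
  by congr pull_back; apply/rowP => i; rewrite !mxE; ring.
have DPx := invariant_map Dx; have MPx := invariant_M DPx.
have orth : dot (stable_approx N.+1 (Phi x) (velocity_derivative x w) -
    stable_approx N (Phi x) (velocity_derivative x w)) (nu' x) = 0.
  by rewrite dotDl dotNl !stable_approx_orth // subrr.
apply: (le_trans (transverse_sq_pull_back M'x orth)).
apply: (le_trans (IH _ _ DPx)).
have h0 : 0 <= B * mu ^+ N by rewrite mulr_ge0 // exprn_ge0 // ltW.
rewrite ler_pXn2r ?nnegrE ?mulr_ge0 ?nrm_ge0 ?exprn_ge0 ?(ltW mu0) //.
rewrite exprSr mulrA -(mulrA (B * mu ^+ N)) ler_wpM2l //.
exact: velocity_derivative_le.
Qed.

Let rate : R := B / law_cos_min lam.

Lemma rate_ge0 : 0 <= rate.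
Proof. by rewrite divr_ge0 // ltW // (law_cos_min_gt0 lawE). Qed.

Lemma stable_approx_nrm N x w : D x ->
  nrm (stable_approx N.+1 x w - stable_approx N x w) <= rate * nrm w * mu ^+ N.
Proof.
move=> Dx; have /andP[mu0 mu1] := mu01.
have -> : rate * nrm w * mu ^+ N = B * mu ^+ N * nrm w / law_cos_min lam.
  by rewrite /rate; ring.
apply: nrm_le_transverse => //; last exact: stable_approx_step.
  by rewrite dotDl dotNl !stable_approx_orth ?subrr //; exact: invariant_M.
by rewrite !mulr_ge0 ?nrm_ge0 ?exprn_ge0 // ltW.
Qed.

(** * The stable graph and the splitting *)

Definition stable_graph x w : V :=
  xget 0 [set l : V | stable_approx N x w @[N --> \oo] --> l].

Lemma stable_graph_spec x w : D x ->
  stable_approx N x w @[N --> \oo] --> stable_graph x w /\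
  forall N, nrm (stable_graph x w - stable_approx N x w) <=
    rate * nrm w / (1 - mu) * mu ^+ N.
Proof.
move=> Dx.
have c0 : 0 <= rate * nrm w by rewrite mulr_ge0 ?nrm_ge0 ?rate_ge0.
have [l [cl Hl]] := geometric_limit c0 mu01 (fun N => stable_approx_nrm N w Dx).
suff -> : stable_graph x w = l by [].
by apply: xget_unique => // l' cl'; exact: (@cvg_row_unique _ _ (fun N => stable_approx N x w) _ _ cl' cl).
Qed.

Lemma stable_graph_cvg x w : D x -> stable_approx N x w @[N --> \oo] --> stable_graph x w.
Proof. by case/(stable_graph_spec w). Qed.

Lemma stable_graph_unique x w (l : V) : D x ->
  stable_approx N x w @[N --> \oo] --> l -> stable_graph x w = l.
Proof. by move=> Dx cl; exact: (@cvg_row_unique _ _ (fun N => stable_approx N x w) _ _ (@stable_graph_cvg x w Dx) cl). Qed.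

Lemma stable_graph_linear x : D x -> linear (stable_graph x).
Proof.
move=> Dx k u w; apply: stable_graph_unique => //.
under eq_cvg do rewrite stable_approx_linear.
by apply: cvgD; [apply: cvgZr|]; exact: stable_graph_cvg.
Qed.

(** The limit of the recursion. Read forwards, it is the invariance of the graph under the
    derivative. *)
Lemma stable_graph_fixed x w : D x -> stable_graph x w =
  pull_back x (stable_graph (Phi x) (velocity_derivative x w) - tau x *: w).
Proof.
move=> Dx; apply: stable_graph_unique => //; rewrite -cvg_shiftS.
have Mx := invariant_M Dx.
apply: (linear_cvg_comp (T := fun _ => pull_back x)) => [|||].
- by apply: filterE => N; exact: pull_back_linear.
- exact: pull_back_linear.
- by move=> u; exact: cvg_cst.
- apply: cvgB; last exact: cvg_cst.
  exact: (stable_graph_cvg (invariant_map Dx)).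
Qed.

Lemma stable_graph_orth x w : D x -> dot (stable_graph x w) (nu x) = 0.
Proof.
by move=> Dx; rewrite stable_graph_fixed //; apply/oblique_orth/phase_transversal/invariant_M.
Qed.

(** The graph is defined on all of [V]; its vanishing on the radial direction makes it depend only
    on the tangential part of the velocity. *)
Lemma stable_graph_radial x : D x -> stable_graph x x.2 = 0.
Proof.
move=> Dx; have M'x := invariant_M' Dx.
rewrite stable_graph_fixed // velocity_derivative_radial //.
have Dx' := invariant_map Dx.
have -> : stable_graph (Phi x) 0 = 0.
  apply: stable_graph_unique => //; apply: cvg_near_cst; apply: filterE => N.
  have := stable_approx_linear N (Phi x) (-1) 0 0.
  by rewrite scaler0 addr0 scaleN1r addNr.
rewrite /pull_back sub0r -[- _]add0r obliqueB; last exact/phase_transversal/invariant_M.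
by apply: oblique_id; rewrite dot0l.
Qed.

Lemma stable_graph_nrm x w : D x -> nrm (stable_graph x w) <= rate / (1 - mu) * nrm w.
Proof.
move=> Dx; have [_ /(_ 0%N)] := stable_graph_spec w Dx.
by rewrite /= subr0 expr0 mulr1 mulrAC.
Qed.

Lemma map_derivative_stable x w : D x ->
  map_derivative x (stable_graph x w, w) =
  (stable_graph (Phi x) (velocity_derivative x w), velocity_derivative x w).
Proof.
move=> Dx; have [_ _ vn _] := step (invariant_M' Dx); have Dx' := invariant_map Dx.
rewrite /map_derivative /=; congr pair.
rewrite (stable_graph_fixed w Dx) /pull_back.
have E z k : z - tau x *: w - k *: x.2 + tau x *: w = z - k *: x.2.
  by rewrite addrAC subrK.
rewrite {2}/oblique E obliqueB ?lt_eqF //.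
by apply: oblique_id; exact: stable_graph_orth.
Qed.

(** Idempotents on all of [W] whose images are the bundles, so that continuity reduces to pointwise
    convergence. In the first component [h.2] need not be made tangential, the graph being 0 on the
    radial direction. *)
Definition stable_proj x (h : W) : W :=
  (stable_graph x h.2, h.2 - dot h.2 x.2 *: x.2).

Definition unstable_proj x (h : W) : W :=
  (h.1 - dot h.1 (nu x) *: nu x, 0).

Definition stable_space x : {vspace W} := limg (linfun (stable_proj x)).
Definition unstable_space x : {vspace W} := limg (linfun (unstable_proj x)).

Lemma stable_proj_linear x : D x -> linear (stable_proj x).
Proof.
move=> Dx k u w; rewrite /stable_proj /= stable_graph_linear //; congr pair.
by rewrite dotDl dotZl; apply/rowP => i; rewrite !mxE; ring.
Qed.

Lemma unstable_proj_linear x : linear (unstable_proj x).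
Proof.
move=> k u w; rewrite /unstable_proj /=; congr pair; last first.
  by rewrite /= scaler0 addr0.
by rewrite dotDl dotZl; apply/rowP => i; rewrite !mxE; ring.
Qed.

Lemma stable_graph_tangent x w (k : R) : D x ->
  stable_graph x (w - k *: x.2) = stable_graph x w.
Proof.
move=> Dx; rewrite addrC -scaleNr stable_graph_linear //.
by rewrite stable_graph_radial // scaler0 add0r.
Qed.

Lemma stable_projK x h : D x -> stable_proj x (stable_proj x h) = stable_proj x h.
Proof.
move=> Dx; have v1 := phase_unit (invariant_M Dx).
rewrite /stable_proj /= stable_graph_tangent //; congr pair.
by rewrite dotDl dotNl dotZl v1 mulr1 subrr scale0r subr0.
Qed.

Lemma unstable_projK x h : M x -> unstable_proj x (unstable_proj x h) = unstable_proj x h.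
Proof.
move=> /nuM[n1 _]; rewrite /unstable_proj /=; congr pair.
by rewrite dotDl dotNl dotZl n1 mulr1 subrr scale0r subr0.
Qed.

Lemma mem_stable_space x h : D x ->
  h \in stable_space x <-> h.1 = stable_graph x h.2 /\ dot h.2 x.2 = 0.
Proof.
move=> Dx; have v1 := phase_unit (invariant_M Dx).
have E := mem_limg_proj h (stable_proj_linear Dx) (fun z : W => stable_projK z Dx).
rewrite /stable_space; apply: (iff_trans E).
case: h {E} => a b; rewrite /stable_proj /=; split=> [[<- bE]|[-> ->]]; last first.
  by rewrite scale0r subr0.
by split => //; rewrite -bE dotDl dotNl dotZl v1 mulr1 subrr.
Qed.

Lemma mem_unstable_space x h : M x ->
  h \in unstable_space x <-> dot h.1 (nu x) = 0 /\ h.2 = 0.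
Proof.
move=> Mx; have [n1 _] := nuM Mx.
have E := mem_limg_proj h (unstable_proj_linear x) (fun z : W => unstable_projK z Mx).
rewrite /unstable_space; apply: (iff_trans E).
case: h {E} => a b; rewrite /unstable_proj /=; split=> [[aE <-]|[-> ->]]; last first.
  by rewrite scale0r subr0.
by split => //; rewrite -aE dotDl dotNl dotZl n1 mulr1 subrr.
Qed.

Lemma tangent_splitting x : D x ->
  [set h | dot h.1 (nu x) = 0 /\ dot h.2 x.2 = 0] =
  [set h | h \in (stable_space x + unstable_space x)%VS].
Proof.
move=> Dx; have Mx := invariant_M Dx; apply/seteqP; split => h /=.
  move=> [h1 h2]; rewrite (_ : h = (stable_graph x h.2, h.2) + (h.1 - stable_graph x h.2, 0)).
    apply: memv_add; first exact/mem_stable_space.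
    apply/mem_unstable_space => //=; split => //.
    by rewrite dotDl dotNl h1 stable_graph_orth // subrr.
  case: h {h1 h2} => a b /=; apply: injective_projections => /=; last by rewrite addr0.
  by rewrite addrC subrK.
move=> /memv_addP[u /(mem_stable_space _ Dx)[u1 u2] [w /(mem_unstable_space _ Mx)[w1 w2] ->]].
rewrite /= !dotDl u1 u2 w1 w2 stable_graph_orth // dot0l.
by rewrite !addr0.
Qed.

Lemma stable_unstable_disjoint x : D x -> (stable_space x :&: unstable_space x = 0)%VS.
Proof.
move=> Dx; have Mx := invariant_M Dx; apply/eqP; rewrite -subv0; apply/subvP => h.
rewrite memv_cap memv0 => /andP[/(mem_stable_space _ Dx)[h1 _] /(mem_unstable_space _ Mx)[_ h2]].
move: h1; rewrite h2 -[X in stable_graph x X](subrr x.2) -[X in _ - X]scale1r.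
rewrite stable_graph_tangent // stable_graph_radial // => h1.
by apply/eqP; apply: injective_projections.
Qed.

(** * Continuity of the bundles on the invariant domain *)

Lemma invariant_within x : within D (nbhs x) --> within M (nbhs x).
Proof.
move=> Q MQ; have H : \forall y \near x, M y -> Q y := MQ.
suff : \forall y \near x, D y -> Q y by [].
by apply: filterS H => y MQy /invariant_M.
Qed.

Lemma cvg_invariant (U : Type) (h : W -> U) (F : set_system U) x :
  h y @[y --> within M (nbhs x)] --> F -> h y @[y --> within D (nbhs x)] --> F.
Proof. by move=> hF Q /hF; exact: invariant_within. Qed.

Lemma near_invariant x : \forall y \near within D (nbhs x), D y.
Proof. exact: withinT. Qed.

Lemma cvg_map x : D x -> Phi y @[y --> within D (nbhs x)] --> within D (nbhs (Phi x)).
Proof.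
move=> Dx Q DQ; have H : \forall y \near Phi x, D y -> Q y := DQ.
have [e e0 eQ] := near_enormP H.
have [c c0 Hc] := is_derivative_continuous (is_derivative_step (invariant_M' Dx)).
have {}Hc : \forall y \near x, M y -> enorm (Phi y - Phi x) <= c * enorm (y - x) := Hc.
have ec : 0 < e / c by rewrite divr_gt0.
suff : \forall y \near x, D y -> Q (Phi y) by [].
apply: filterS2 Hc (near_enorm x ec) => y Hy ye Dy.
apply: eQ; last exact: invariant_map.
by apply: (le_lt_trans (Hy (invariant_M Dy))); rewrite mulrC -ltr_pdivlMr.
Qed.

Lemma cvg_invariant_velocity x : y.2 @[y --> within D (nbhs x)] --> x.2.
Proof. exact: cvg_invariant (@cvg_velocity x). Qed.

Lemma cvg_flight_time x : D x -> tau y @[y --> within D (nbhs x)] --> tau x.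
Proof.
move=> Dx; apply: cvg_dot; last exact: cvg_invariant_velocity.
apply: cvgB; last exact: cvg_invariant (@cvg_position x).
by apply: (cvg_comp _ _ (cvg_map Dx)); apply: cvg_within_filter; exact: cvg_fst.
Qed.

Lemma cvg_pull_back x u : D x ->
  pull_back y u @[y --> within D (nbhs x)] --> pull_back x u.
Proof.
move=> Dx; have Mx := invariant_M Dx.
have c : oblique (nu x) y.2 u @[y --> within D (nbhs x)] --> pull_back x u.
  by apply: oblique_cvg; [exact: phase_transversal|exact: cvg_invariant_velocity].
apply: cvg_trans c; apply: near_eq_cvg.
have H : \forall y \near within D (nbhs x), nu y = nu x.
  exact: invariant_within (near_nu Mx).
by apply: filterS H => y; rewrite /pull_back => ->.
Qed.

Lemma cvg_velocity_derivative x w : D x ->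
  velocity_derivative y w @[y --> within D (nbhs x)] --> velocity_derivative x w.
Proof.
move=> Dx; have M'x := invariant_M' Dx; have [_ n1 _ _] := step M'x.
have hv := incidence_hemisphere M'x.
have c : law_derivative g g' (nu' x) (reflect_normal (nu' x) y.2) (reflect_normal (nu' x) w)
    @[y --> within M (nbhs x)] --> velocity_derivative x w.
  have cT z : law_derivative g g' (nu' x) u z
      @[u --> within [set u : V | dot u u = 1] (nbhs (incidence x))] -->
      law_derivative g g' (nu' x) (incidence x) z.
    exact: (cvg_law_derivative lawE n1 hv).
  exact: cvg_comp (cvg_incidence M'x) (cT _).
apply: cvg_trans (cvg_invariant c); apply: near_eq_cvg.
have H : \forall y \near within D (nbhs x), nu' y = nu' x.
  by apply: filterS (invariant_within (near_step M'x)) => y [].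
by apply: filterS H => y; rewrite /velocity_derivative /incidence => ->.
Qed.

Lemma cvg_stable_approx N x w : D x ->
  stable_approx N y w @[y --> within D (nbhs x)] --> stable_approx N x w.
Proof.
elim: N x w => [|N IH] x w Dx /=; first exact: cvg_cst.
apply: (linear_cvg_comp (T := pull_back)).
- by apply: filterE => y; exact: pull_back_linear.
- exact: pull_back_linear.
- by move=> u; exact: cvg_pull_back.
apply: cvgB; last by apply: cvgZ; [exact: cvg_flight_time|exact: cvg_cst].
apply: (linear_cvg_comp (T := fun y => stable_approx N (Phi y))
  (L := stable_approx N (Phi x))).
- by apply: filterE => y; exact: stable_approx_linear.
- exact: stable_approx_linear.
- move=> u; have IHu : stable_approx N z u @[z --> within D (nbhs (Phi x))] -->
      stable_approx N (Phi x) u by exact: IH (invariant_map Dx).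
  exact: cvg_comp (cvg_map Dx) IHu.
- exact: cvg_velocity_derivative.
Qed.

(** A uniform limit of continuous functions: the tail bound depends on [w] and [N] but not on the
    point of [D]. *)
Lemma cvg_stable_graph x w : D x ->
  stable_graph y w @[y --> within D (nbhs x)] --> stable_graph x w.
Proof.
move=> Dx; apply/cvg_nrmP => e e0; have /andP[mu0 mu1] := mu01.
have e3 : 0 < e / 3 by rewrite divr_gt0.
have tail : rate * nrm w / (1 - mu) * mu ^+ N @[N --> \oo] --> 0.
  rewrite -(mulr0 (rate * nrm w / (1 - mu))); apply: cvgM; first exact: cvg_cst.
  by apply: cvg_expr; rewrite gtr0_norm.
move/cvgrPdist_le : tail => /(_ _ e3)[N _ /(_ N (leqnn N))].
rewrite /= sub0r normrN => /(le_trans (ler_norm _)) tailN.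
have /cvg_nrmP/(_ _ e3) := @cvg_stable_approx N x w Dx.
apply: filterS2 (near_invariant x) => y Dy Hy.
have h1 := le_trans ((stable_graph_spec w Dy).2 N) tailN.
have h2 := le_trans ((stable_graph_spec w Dx).2 N) tailN.
have -> : stable_graph y w - stable_graph x w =
    (stable_graph y w - stable_approx N y w) + (stable_approx N y w - stable_approx N x w)
    - (stable_graph x w - stable_approx N x w).
  by apply/rowP => i; rewrite !mxE; ring.
apply: (le_trans (nrmB _ _)); have h3 := nrmD (stable_graph y w - stable_approx N y w)
  (stable_approx N y w - stable_approx N x w).
by apply: (le_trans (lerD (le_trans h3 (lerD h1 Hy)) h2)); lra.
Qed.

Lemma stable_space_continuous : continuous_subspaces D stable_space.
Proof.
apply: continuous_subspaces_proj => x Dx.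
- exact: stable_proj_linear.
- by move=> w; exact: stable_projK.
- by move=> u; exact: cvg_stable_graph.
- move=> u /=; apply: cvgB; first exact: cvg_cst.
  apply: cvgZ; last exact: cvg_invariant_velocity.
  by apply: cvg_dot; [exact: cvg_cst|exact: cvg_invariant_velocity].
Qed.

Lemma unstable_space_continuous : continuous_subspaces D unstable_space.
Proof.
apply: continuous_subspaces_proj => x Dx.
- exact: unstable_proj_linear.
- by move=> w; apply: unstable_projK; exact: invariant_M.
- move=> u; apply: cvg_near_cst.
  (* The normal is locally constant, hence so is the bundle. *)
  have H : \forall y \near within D (nbhs x), nu y = nu x.
    exact: invariant_within (near_nu (invariant_M Dx)).
  by apply: filterS H => y; rewrite /unstable_proj => ->.
- by move=> u; exact: cvg_cst.
Qed.

(** * Invariance of the bundles *)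

Lemma map_derivativeE x h : linfun (map_derivative x) h = map_derivative x h.
Proof. exact: linfun_linear (map_derivative_linear x). Qed.

Lemma stable_space_map x h : D x -> h \in stable_space x ->
  map_derivative x h \in stable_space (Phi x).
Proof.
move=> Dx /(mem_stable_space _ Dx)[h1 h2]; have Dx' := invariant_map Dx.
rewrite [h]surjective_pairing h1 map_derivative_stable //.
apply/mem_stable_space => //=; split => //.
exact: velocity_derivative_tangent (invariant_M' Dx).
Qed.

Lemma velocity_derivative0 x : velocity_derivative x 0 = 0.
Proof.
have := velocity_derivative_linear x (-1) 0 0.
by rewrite scaler0 addr0 scaleN1r addNr.
Qed.

Lemma unstable_space_map x h : D x -> h \in unstable_space x ->
  map_derivative x h = (oblique (nu' x) x.2 h.1, 0) /\
  map_derivative x h \in unstable_space (Phi x).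
Proof.
move=> Dx /(mem_unstable_space _ (invariant_M Dx))[h1 h2].
have [_ _ vn _] := step (invariant_M' Dx).
have E : map_derivative x h = (oblique (nu' x) x.2 h.1, 0).
  by rewrite /map_derivative h2 scaler0 addr0 velocity_derivative0.
split => //; rewrite E; apply/mem_unstable_space => /=.
  exact: invariant_M (invariant_map Dx).
by split => //; apply: oblique_orth; rewrite lt_eqF.
Qed.

Lemma stable_space_img x : D x ->
  (linfun (map_derivative x) @: stable_space x <= stable_space (Phi x))%VS.
Proof.
move=> Dx; apply/subvP => h /memv_imgP[u ux ->].
by rewrite map_derivativeE; exact: stable_space_map.
Qed.

(** On graph vectors injectivity of the full derivative becomes injectivity of the velocity
    derivative on tangent velocities. By dimension it is then onto the tangent velocities at the
    next point, and the graphs follow. *)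
Lemma stable_space_img_eq x : D x ->
  (forall u : W, dot u.1 (nu x) = 0 /\ dot u.2 x.2 = 0 ->
     map_derivative x u = 0 -> u = 0) ->
  (linfun (map_derivative x) @: stable_space x)%VS = stable_space (Phi x).
Proof.
move=> Dx inj; apply/eqP; rewrite eqEsubv stable_space_img //=.
have M'x := invariant_M' Dx; have Dx' := invariant_map Dx.
have v1 := phase_unit (invariant_M Dx); have v1' := phase_unit (invariant_M Dx').
(* The added term sends [x.2], killed by the velocity derivative, to [(Phi x).2]. The map between
   two tangent spaces becomes an endomorphism of [V], which is onto as soon as it is injective. *)
pose H w := velocity_derivative x w + dot w x.2 *: (Phi x).2.
have lH : linear H.
  move=> k u w; rewrite /H velocity_derivative_linear dotDl dotZl.
  by apply/rowP => i; rewrite !mxE; ring.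
pose H' : {linear V -> V} := HB.pack H (GRing.isLinear.Build R V V *:%R H lH).
have HE w : linfun H w = H w := lfunE H' w.
have Hdot w : dot (H w) (Phi x).2 = dot w x.2.
  by rewrite dotDl dotZl v1' mulr1 velocity_derivative_tangent // add0r.
have /lker0_limgf surj : lker (linfun H) == 0%VS.
  rewrite -subv0; apply/subvP => w; rewrite memv_ker HE memv0 => /eqP Hw.
  have wv : dot w x.2 = 0 by rewrite -Hdot Hw dot0l.
  have vw : velocity_derivative x w = 0 by rewrite -Hw /H wv scale0r addr0.
  have := inj (stable_graph x w, w); rewrite /= stable_graph_orth // => /(_ (conj erefl wv)).
  rewrite map_derivative_stable // vw => h.
  have S0 : stable_graph (Phi x) 0 = 0.
    have := stable_graph_linear Dx' (-1) 0 0.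
    by rewrite scaler0 addr0 scaleN1r addNr.
  by rewrite S0 in h; have [_ ->] := h erefl.
apply/subvP => h /(mem_stable_space _ Dx')[h1 h2].
have : h.2 \in limg (linfun H) by rewrite surj memvf.
move=> /memv_imgP[w _]; rewrite HE => hE.
have wv : dot w x.2 = 0 by rewrite -Hdot -hE.
have vw : velocity_derivative x w = h.2 by rewrite hE /H wv scale0r addr0.
rewrite [h]surjective_pairing h1 -vw -map_derivative_stable // -map_derivativeE.
by apply: memv_img; apply/mem_stable_space.
Qed.

Definition unstable_back x (h : W) : W := (pull_back x h.1, 0).

Lemma unstable_back_linear x : linear (unstable_back x).
Proof.
by move=> k u w; rewrite /unstable_back /= pull_back_linear; congr pair; rewrite /= scaler0 addr0.
Qed.

Lemma unstable_backE x h : linfun (unstable_back x) h = unstable_back x h.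
Proof. exact: linfun_linear (unstable_back_linear x). Qed.

Lemma unstable_back_mem x h : D x -> unstable_back x h \in unstable_space x.
Proof.
move=> Dx; have Mx := invariant_M Dx; apply/mem_unstable_space => //=; split => //.
by apply: oblique_orth; exact: phase_transversal.
Qed.

Lemma unstable_backK x h : D x -> h \in unstable_space (Phi x) ->
  map_derivative x (unstable_back x h) = h.
Proof.
move=> Dx hx; have [-> _] := unstable_space_map Dx (unstable_back_mem h Dx).
have [_ _ vn _] := step (invariant_M' Dx).
move: hx => /(mem_unstable_space _ (invariant_M (invariant_map Dx)))[h1 h2].
rewrite [h in RHS]surjective_pairing h2; congr pair => /=.
by rewrite /pull_back {2}/oblique obliqueB ?lt_eqF // oblique_id.
Qed.

Lemma map_derivativeK x h : D x -> h \in unstable_space x ->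
  unstable_back x (map_derivative x h) = h.
Proof.
move=> Dx hx; have [-> _] := unstable_space_map Dx hx.
move: hx => /(mem_unstable_space _ (invariant_M Dx))[h1 h2].
rewrite [h in RHS]surjective_pairing h2 /unstable_back; congr pair => /=.
have vn := phase_transversal (invariant_M Dx).
by rewrite {1}/oblique /pull_back obliqueB // oblique_id.
Qed.

Lemma unstable_space_img x : D x ->
  (linfun (map_derivative x) @: unstable_space x)%VS = unstable_space (Phi x).
Proof.
move=> Dx; apply/eqP; rewrite eqEsubv; apply/andP; split; apply/subvP => h.
  move=> /memv_imgP[u ux ->]; rewrite map_derivativeE.
  by have [] := unstable_space_map Dx ux.
move=> hx; rewrite -(unstable_backK Dx hx) -map_derivativeE.
by apply: memv_img; exact: unstable_back_mem.
Qed.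

(** * Growth of the iterates on both bundles *)

Lemma stable_iterate n x h : D x -> h \in stable_space x ->
  iterate_derivative n x h \in stable_space (iter n Phi x) /\
  nrm (iterate_derivative n x h).2 <= mu ^+ n * nrm h.2.
Proof.
move=> Dx hx; have /andP[mu0 _] := mu01.
elim: n => [|n [IH1 IH2]] /=; first by rewrite id_lfunE mul1r.
have Dn := invariant_iter n Dx; rewrite comp_lfunE map_derivativeE; split.
  exact: stable_space_map.
apply: (le_trans (velocity_derivative_le _ (invariant_M' Dn))).
by rewrite exprS -mulrA ler_wpM2l // ltW.
Qed.

Fixpoint iterate_back (n : nat) x : 'End(W) :=
  if n is k.+1 then
    (iterate_back k x \o linfun (unstable_back (iter k Phi x)))%VF
  else \1%VF.

Lemma unstable_iterate n x h : D x -> h \in unstable_space x ->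
  iterate_derivative n x h \in unstable_space (iter n Phi x) /\
  iterate_back n x (iterate_derivative n x h) = h.
Proof.
move=> Dx hx; elim: n => [|n [IH1 IH2]] /=; first by rewrite !id_lfunE.
have Dn := invariant_iter n Dx; rewrite !comp_lfunE map_derivativeE unstable_backE.
by have [_ ->] := unstable_space_map Dn IH1; rewrite map_derivativeK.
Qed.

Lemma iterate_back_le n x h : D x -> h \in unstable_space (iter n Phi x) ->
  iterate_back n x h \in unstable_space x /\
  transverse_sq x (iterate_back n x h).1 <= transverse_sq (iter n Phi x) h.1.
Proof.
move=> Dx; elim: n h => [|n IH] h /= hn; first by rewrite id_lfunE.
have Dn := invariant_iter n Dx.
rewrite comp_lfunE unstable_backE; have [H1 H2] := IH _ (unstable_back_mem h Dn).
split => //; apply: (le_trans H2); apply: transverse_sq_pull_back.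
  exact: invariant_M'.
by have [] := (mem_unstable_space _ (invariant_M (invariant_map Dn))).1 hn.
Qed.

Lemma enorm_iterate_back n x h : D x -> h \in unstable_space (iter n Phi x) ->
  enorm (iterate_back n x h) <= (law_cos_min lam)^-1 * enorm h.
Proof.
move=> Dx hn; have [Kx Kle] := iterate_back_le Dx hn.
have [K1 K2] := (mem_unstable_space _ (invariant_M Dx)).1 Kx.
have -> : enorm (iterate_back n x h) = nrm (iterate_back n x h).1.
  by rewrite {1}[iterate_back n x h]surjective_pairing K2 enorm_fst.
rewrite mulrC; apply: nrm_le_transverse => //; first exact: enorm_ge0.
apply: (le_trans Kle); apply: (@le_trans _ _ (dot h.1 h.1)); first by rewrite gerBl sqr_ge0.
by rewrite -sqr_nrm ler_pXn2r ?nnegrE ?nrm_ge0 ?enorm_ge0 // nrm_fst_le.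
Qed.

Lemma enorm_stable_iterate n x h : D x -> h \in stable_space x ->
  enorm (iterate_derivative n x h) <= (rate / (1 - mu) + 1) * mu ^+ n * enorm h.
Proof.
move=> Dx hx; have [H1 H2] := stable_iterate n Dx hx; have /andP[mu0 mu1] := mu01.
have Dn := invariant_iter n Dx.
have [E _] := (mem_stable_space _ Dn).1 H1.
have c0 : 0 <= rate / (1 - mu) by rewrite divr_ge0 ?rate_ge0 // subr_ge0 ltW.
apply: (le_trans (enorm_le _)); rewrite E.
apply: (le_trans (lerD (stable_graph_nrm _ Dn) (lexx _))).
rewrite -[X in _ + X]mul1r -mulrDl -mulrA ler_wpM2l ?addr_ge0 //.
by apply: (le_trans H2); rewrite ler_wpM2l ?nrm_snd_le // exprn_ge0 // ltW.
Qed.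

Lemma skew_product_partially_hyperbolic (Tan : W -> set W) :
  (forall x, M x -> Tan x = [set h | dot h.1 (nu x) = 0 /\ dot h.2 x.2 = 0]) ->
  uniformly_partially_hyperbolic M M' Phi Tan.
Proof.
move=> TanE; have /andP[mu0 mu1] := mu01; have k0 := law_cos_min_gt0 lawE.
have D1 x : iterate_derivative 1 x = linfun (map_derivative x).
  by rewrite /= comp_lfun1r.
have c0 : 0 <= rate / (1 - mu) by rewrite divr_ge0 ?rate_ge0 // subr_ge0 ltW.
have k1 : 0 < (law_cos_min lam)^-1 by rewrite invr_gt0.
(* [sigma = 1], as the inverse iterates are merely bounded on positions. The last constant is the
   sum of the bounds on the two bundles, so it serves for both. *)
exists iterate_derivative, stable_space, unstable_space, mu, 1,
  (rate / (1 - mu) + 1 + (law_cos_min lam)^-1); split.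
- move=> n x Dx; apply: is_derivative_iterate => k; exact: invariant_forward.
- split.
  + by move=> x Dx; rewrite (TanE _ (invariant_M Dx)); exact: tangent_splitting.
  + exact: stable_unstable_disjoint.
  + exact: stable_space_continuous.
  + exact: unstable_space_continuous.
- move=> x Dx; rewrite D1; split.
  + exact: stable_space_img.
  + move=> inj; apply: stable_space_img_eq => // u ux u0.
    by apply: inj; rewrite ?map_derivativeE ?(TanE _ (invariant_M Dx)).
  + exact: unstable_space_img.
- by split; rewrite ?mu01 // addr_gt0 // ltr_wpDl.
- move=> n x _ Dx; split.
    move=> h hx; apply: (le_trans (enorm_stable_iterate n Dx hx)).
    rewrite ler_wpM2r ?enorm_ge0 // ler_wpM2r ?exprn_ge0 ?(ltW mu0) //.
    by rewrite lerDl ltW.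
  exists (iterate_back n x); split=> [h hx|h hn].
    by have [_] := unstable_iterate n Dx hx.
  rewrite expr1n invr1 mulr1; apply: (le_trans (enorm_iterate_back Dx hn)).
  by rewrite ler_wpM2r ?enorm_ge0 // lerDr addr_ge0.
Qed.

End SkewProduct.

Theorem proposition2p9 (R : realType) (d : nat) (hd : (2 <= d)%N)
    (P : set 'rV[R]_d) (hP : is_polytope P) (hPd : has_dim P d)
    (f : R -> R) (hf : contracting_reflection_law f) :
  uniformly_partially_hyperbolic
    (phase_space P) (billiard_domain P) (billiard_map f P)
    (billiard_tangent P).
Proof.
have [lam [g [g' lawE]]] := exists_law_extension hf.
have [mu [mu01 g'_le ratio_le]] := sin_ratio_le lawE.
have [B B0 tau_le] := polytope_diam f hP hPd.
apply: (@skew_product_partially_hyperbolic R d lam f g g' mu lawE mu01 g'_le ratio_le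
  (phase_space P) (billiard_domain P) (billiard_map f P)
  (fun x => facet_normal_at P x.1) B) => //.
- by move=> x [].
- by move=> x /(phase_space_normal hP hPd)[[n1 _] hv].
(* Points of the phase space have flat positions, and the flat points near [x.1] share its
   normal. *)
- move=> x Mx; have [fl _] := phase_space_normal hP hPd Mx.
  have c1 : y.1 @[y --> within (phase_space P) (nbhs x)] --> x.1.
    by apply: cvg_within_filter; exact: cvg_fst.
  have h1 : \forall y \near within (phase_space P) (nbhs x), (exists m, flat P y.1 m) ->
      facet_normal_at P y.1 = facet_normal_at P x.1 /\
      flat P y.1 (facet_normal_at P x.1).
    exact: c1 _ (near_facet_normal_at hP fl).
  have h2 : \forall y \near within (phase_space P) (nbhs x), phase_space P y.
    exact: withinT.
  apply: filterS2 h1 h2 => y h1 /(phase_space_normal hP hPd)[fly _].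
  by have [] := h1 (ex_intro _ _ fly).
- move=> x M'x; have [_ qE [n1 _] vn PhiE] := billiard_domain_map f hP hPd M'x.
  by split.
- by move=> x M'x; exact: billiard_map_local.
- move=> x Mx; apply/seteqP.
  by split=> h; rewrite (billiard_tangent_normal hP hPd).
Qed.
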